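(* Let $r,c,p$ be nonnegative integers (with $r\ge 1$ in the identities whose left-hand side involves the shape $(c^{r-1},c-p)$). (i) If $c\ge p$, then $$s\big((c^{r-1},c-p);\mathbf x\big)=\sum_{\nu\subseteq (c^r),\ \operatorname{oddcols}((c^r)/\nu)=p}\operatorname{sp}(\nu;\mathbf x).$$ (ii) If $r\ge p$ (and $(c^{r-p},(c-1)^p)$ is a partition), then $$s\big((c^{r-p},(c-1)^p);\mathbf x\big)=\sum_{\nu\subseteq (c^r),\ \operatorname{oddrows}((c^r)/\nu)=p}\operatorname{o}(\nu;\mathbf x).$$ (iii) If $r\le N$ and $c\ge p$, then $$s_N\big((c^{r-1},c-p);\mathbf x^{\pm1}\big)=\begin{cases}\displaystyle\sum_{\nu\subseteq (c^r),\ \operatorname{oddcols}((c^r)/\nu)=p}\operatorname{sp}_N(\nu;\mathbf x^{\pm1}) & \text{if } r\le\lceil N/2\rceil,\\[2mm] \displaystyle\sum_{\nu\subseteq (c^{N-r+1}),\ \operatorname{oddcols}((c^{N-r+1})/\nu)=c-p}\operatorname{sp}_N(\nu;\mathbf x^{\pm1}) & \text{if } r>\lceil N/2\rceil.\end{cases}$$ (iv) If $r\le 2n+1$, then $$s_{2n+1}\big((c^{r});\mathbf x^{\pm1}\big)=\begin{cases}\displaystyle\sum_{\nu\subseteq (c^r)}\operatorname{sp}_{2n}(\nu;\mathbf x^{\pm1}) & \text{if } r\le n,\\[2mm] \displaystyle\sum_{\nu\subseteq (c^{2n+1-r})}\operatorname{sp}_{2n}(\nu;\mathbf x^{\pm1})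 & \text{if } r>n.\end{cases}$$ (v) If $p\le r\le\lfloor N/2\rfloor$ (and $(c^{r-p},(c-1)^p)$ is a partition), then $$s_N\big((c^{r-p},(c-1)^p);\mathbf x^{\pm1}\big)=\sum_{\nu\subseteq (c^r),\ \operatorname{oddrows}((c^r)/\nu)=p}\operatorname{o}_N(\nu;\mathbf x^{\pm1}).$$ All sums run over partitions $\nu$.
   Context: A partition is a sequence $\lambda=(\lambda_1,\dots,\lambda_r)$ of integers with $\lambda_1\ge\dots\ge\lambda_r\ge0$; partitions differing only by trailing zeros are identified. It is identified with its Ferrers diagram ($\lambda_i$ left-justified cells in row $i$). $\mu\subseteq\lambda$ means $\mu_i\le\lambda_i$ for all $i$, and then $\lambda/\mu$ denotes the set of cells of $\lambda$ not in $\mu$. $(c^r)$ is the partition with $r$ parts equal to $c$; $(c^{r-1},c-p)$ has $r-1$ parts $c$ followed by one part $c-p$; $(c^{r-p},(c-1)^p)$ has $r-p$ parts $c$ followed by $p$ parts $c-1$. $\operatorname{oddrows}(\sigma)$, $\operatorname{oddcols}(\sigma)$ denote the number of rows, respectively columns, of odd length of a skew diagram $\sigma$. Let $\mathbf x=(x_1,x_2,\dots)$ be indeterminates, $h_m(\mathbf x)=\sum_{1\le i_1\le\dots\le i_m}x_{i_1}\cdots x_{i_m}$ the complete homogeneous symmetric functions ($h_0=1$, $h_m=0$ for $m<0$). For a partition $\lambda=(\lambda_1,\dots,\lambda_r)$ define - the Schur function $s(\lambda;\mathbf x)=\det_{1\le i,j\le r}\big(h_{\lambda_i-i+j}(\mathbf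 x)\big)$; - the universal symplectic character $\operatorname{sp}(\lambda;\mathbf x)=\det_{1\le i,j\le r}(a_{ij})$ with $a_{i1}=h_{\lambda_i-i+1}(\mathbf x)$ and $a_{ij}=h_{\lambda_i-i+j}(\mathbf x)+h_{\lambda_i-i-j+2}(\mathbf x)$ for $j\ge2$; - the universal orthogonal character $\operatorname{o}(\lambda;\mathbf x)=\det_{1\le i,j\le r}\big(h_{\lambda_i-i+j}(\mathbf x)-h_{\lambda_i-i-j}(\mathbf x)\big)$. For $f\in\{s,\operatorname{sp},\operatorname{o}\}$, write $f_{2n}(\lambda;\mathbf x^{\pm1}):=f(\lambda;x_1,x_1^{-1},\dots,x_n,x_n^{-1},0,0,\dots)$ and $f_{2n+1}(\lambda;\mathbf x^{\pm1}):=f(\lambda;x_1,x_1^{-1},\dots,x_n,x_n^{-1},1,0,0,\dots)$. This defines $s_N,\operatorname{sp}_N,\operatorname{o}_N$ for $N=2n$ and $N=2n+1$. *)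

(* Defs.v *)
From HB Require Import structures.
From mathcomp Require Import all_boot all_order all_algebra.
From mathcomp Require Import finmap multiset mpoly boolp.

Set Implicit Arguments.
Unset Strict Implicit.
Unset Printing Implicit Defensive.

Import GRing.Theory.

Local Open Scope mset_scope.
Local Open Scope ring_scope.

(** * Formal power series in countably many indeterminates

    The monomial x_(i1) ... x_(im) in the indeterminates x_0, x_1, ... is the
    multiset {i1, ..., im} of natural numbers; a power series is its family of
    coefficients.  The product is the Cauchy product. *)

(** The submultisets of [A], without repetition. *)
Definition submsets (A : {mset nat}) : seq {mset nat} :=
  undup [seq seq_mset (mask b A) | b : (size A).-tuple bool].

Lemma mem_submsets (A B : {mset nat}) : (B \in submsets A) = (B `<=` A)%mset.
Proof.
rewrite mem_undup; apply/imageP/msubsetP => [[b _ ->] a|leBA].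
  by rewrite mset_seqE -[leqRHS]count_mem_mset leq_count_mask.
have /count_subseqP[s /subseqP[b sz_b ->] eqBs] :
    forall a, (count_mem a B <= count_mem a A)%N.
  by move=> a; rewrite !count_mem_mset.
exists (Tuple (introT eqP sz_b)) => //=.
by rewrite -[LHS]seq_mset_id; apply/eq_seq_msetP.
Qed.

Lemma uniq_submsets A : uniq (submsets A).
Proof. exact: undup_uniq. Qed.

Record pseries (R : Type) := PSeries { coefs : {mset nat} -> R }.
Coercion coefs : pseries >-> Funclass.

Lemma pseriesP (R : Type) (f g : pseries R) : f =1 g -> f = g.
Proof. by case: f g => [f] [g] /= /funext->. Qed.

HB.instance Definition _ (R : Type) := gen_eqMixin (pseries R).
HB.instance Definition _ (R : Type) := gen_choiceMixin (pseries R).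

Section PSeriesRing.
Variable R : comNzRingType.
Implicit Types f g h : pseries R.

Definition ps0 : pseries R := PSeries (fun=> 0).
Definition ps1 : pseries R := PSeries (fun A => (A == mset0)%:R).
Definition psopp f : pseries R := PSeries (fun A => - f A).
Definition psadd f g : pseries R := PSeries (fun A => f A + g A).
Definition psmul f g : pseries R :=
  PSeries (fun A => \sum_(B <- submsets A) f B * g (A `\` B)%mset).

Fact psaddA : associative psadd.
Proof. by move=> f g h; apply: pseriesP => A /=; rewrite addrA. Qed.
Fact psaddC : commutative psadd.
Proof. by move=> f g; apply: pseriesP => A /=; rewrite addrC. Qed.
Fact psadd0 : left_id ps0 psadd.
Proof. by move=> f; apply: pseriesP => A /=; rewrite add0r. Qed.
Fact psaddN : left_inverse ps0 psopp psadd.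
Proof. by move=> f; apply: pseriesP => A /=; rewrite addNr. Qed.

HB.instance Definition _ :=
  GRing.isZmodule.Build (pseries R) psaddA psaddC psadd0 psaddN.

Fact psmulC : commutative psmul.
Proof.
move=> f g; apply: pseriesP => A /=.
have pA : perm_eq (submsets A) [seq (A `\` B)%mset | B <- submsets A].
  apply: uniq_perm (uniq_submsets A) _ _ => [|B].
    rewrite map_inj_in_uniq ?uniq_submsets // => B C.
    rewrite !mem_submsets => leBA leCA eqBC.
    by rewrite -(msetBBK leBA) eqBC msetBBK.
  rewrite mem_submsets; apply/idP/mapP => [leBA|[C _ ->]].
    by exists (A `\` B)%mset; rewrite ?mem_submsets ?msubsetDl ?msetBBK.
  exact: msubsetDl.
rewrite (perm_big _ pA) big_map !big_seq; apply: eq_bigr => B.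
by rewrite mem_submsets => leBA; rewrite msetBBK // mulrC.
Qed.

Fact psmulA : associative psmul.
Proof.
move=> f g h; apply: pseriesP => A /=; apply/esym.
transitivity (\sum_(D <- submsets A) \sum_(E <- submsets A | (E `<=` D)%mset)
    f E * g (D `\` E)%mset * h (A `\` D)%mset).
  rewrite !big_seq; apply: eq_bigr => D; rewrite mem_submsets => leDA.
  rewrite mulr_suml -[RHS]big_filter; apply: perm_big.
  apply: uniq_perm => [||E]; rewrite ?filter_uniq ?uniq_submsets //.
  rewrite mem_filter !mem_submsets; case: (boolP (E `<=` D)%mset) => //= leED.
  by rewrite (msubset_trans leED).
rewrite (exchange_big_dep predT) //= !big_seq.
apply: eq_bigr => E; rewrite mem_submsets => leEA; rewrite mulr_sumr.
have pE : perm_eq [seq D <- submsets A | (E `<=` D)%mset]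
                  [seq (E `+` G)%mset | G <- submsets (A `\` E)%mset].
  apply: uniq_perm => [||D].
  - by rewrite filter_uniq ?uniq_submsets.
  - by rewrite map_inj_uniq ?uniq_submsets //; apply: can_inj (msetDKB E).
  rewrite mem_filter mem_submsets; apply/andP/mapP => [[leED leDA]|[G]].
    by exists (D `\` E)%mset; rewrite ?msetBDKC // mem_submsets msetSB.
  rewrite mem_submsets => leG ->; split.
    by apply/msubsetP => a; rewrite msetE2 leq_addr.
  by rewrite -(msetBDKC leEA) msetDS.
rewrite -big_filter (perm_big _ pE) big_map; apply: eq_bigr => G _.
by rewrite msetDKB msetBDA mulrA.
Qed.

Fact psmul1 : left_id ps1 psmul.
Proof.
move=> f; apply: pseriesP => A /=.
have A0 : mset0 \in submsets A by rewrite mem_submsets msub0set.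
rewrite (bigD1_seq mset0) ?uniq_submsets //= eqxx mul1r msetB0.
by rewrite big1 ?addr0 // => B /negPf->; rewrite mul0r.
Qed.

Fact psmulDl : left_distributive psmul psadd.
Proof.
move=> f g h; apply: pseriesP => A /=; rewrite -big_split.
by apply: eq_bigr => B _; rewrite mulrDl.
Qed.

Fact ps1_neq0 : ps1 != ps0.
Proof.
apply/eqP => /(congr1 (fun f : pseries R => f mset0)) /= /eqP.
by rewrite eqxx oner_eq0.
Qed.

HB.instance Definition _ :=
  GRing.Zmodule_isComNzRing.Build (pseries R)
    psmulA psmulC psmul1 psmulDl ps1_neq0.

End PSeriesRing.

(** * Complete homogeneous symmetric functions *)

(** In the indeterminates x_0, x_1, ...: every monomial of degree [m] is
    x_(i1) ... x_(im) for exactly one sequence i1 <= ... <= im. *)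
Definition hinf (m : nat) : pseries int := PSeries (fun A => (size A == m)%:R).

(** In the finite alphabet [y] (equivalently, in [y] followed by zeros, which
    contribute nothing to the sum). *)
Definition hfin (R : comNzRingType) (y : seq R) (m : nat) : R :=
  \sum_(t : m.-tuple 'I_(size y) | sorted leq (map val t)) \prod_(i <- t) y`_i.

(** The sequence [h] extended by zero to negative indices. *)
Definition hz (R : comNzRingType) (h : nat -> R) (m : int) : R :=
  if m is Posz k then h k else 0.

(** * Schur functions and universal characters

    [h] is the sequence of the complete homogeneous symmetric functions of the
    alphabet.  Rows and columns are numbered from 0, which shifts the constants
    in the indices of [h]. *)
Section Characters.
Variables (R : comNzRingType) (h : nat -> R).
Implicit Type la : seq nat.

Definition schur la : R :=
  \det (\matrix_(i < size la, j < size la)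
          hz h ((nth 0%N la i)%:Z - i%:Z + j%:Z)).

Definition sp_char la : R :=
  \det (\matrix_(i < size la, j < size la)
          (hz h ((nth 0%N la i)%:Z - i%:Z + j%:Z)
           + if (j : nat) == 0%N then 0
             else hz h ((nth 0%N la i)%:Z - i%:Z - j%:Z))).

Definition o_char la : R :=
  \det (\matrix_(i < size la, j < size la)
          (hz h ((nth 0%N la i)%:Z - i%:Z + j%:Z)
           - hz h ((nth 0%N la i)%:Z - i%:Z - j%:Z - 2%:Z))).

End Characters.

(** * Partitions and skew diagrams *)

Definition is_part (la : seq nat) : bool := sorted geq la.

Definition part_sub (mu la : seq nat) : bool :=
  all (fun i => nth 0 mu i <= nth 0 la i)%N (iota 0 (size mu)).

(** The partitions contained in the partition [la], each listed once, padded
    with zeros to [size la] parts. *)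
Definition subparts (la : seq nat) : seq (seq nat) :=
  [seq nu <- [seq map val t | t : (size la).-tuple 'I_(head 0%N la).+1]
     | is_part nu && part_sub nu la].

Definition in_skew (la mu : seq nat) (i j : nat) : bool :=
  (nth 0 mu i <= j < nth 0 la i)%N.

Definition row_length (la mu : seq nat) (i : nat) : nat :=
  count (fun j => in_skew la mu i j) (iota 0 (head 0%N la)).

Definition col_length (la mu : seq nat) (j : nat) : nat :=
  count (fun i => in_skew la mu i j) (iota 0 (size la)).

Definition oddrows (la mu : seq nat) : nat :=
  count (fun i => odd (row_length la mu i)) (iota 0 (size la)).

Definition oddcols (la mu : seq nat) : nat :=
  count (fun j => odd (col_length la mu j)) (iota 0 (head 0%N la)).

(** * The alphabet x_1, 1/x_1, ..., x_n, 1/x_n, with a further letter 1 if [b]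

    The Laurent polynomials in x_1, ..., x_n are taken inside the field of
    rational functions.  The alphabet has [N = n.*2 + b] letters, so that it is
    [xpm N./2 (odd N)] for a given [N]. *)
Definition xpm (n : nat) (b : bool) : seq {fraction {mpoly int[n]}} :=
  flatten [seq [:: tofrac 'X_i; (tofrac 'X_i)^-1] | i <- enum 'I_n]
    ++ nseq b 1.

Definition s_pm (n : nat) (b : bool) := schur (hfin (xpm n b)).
Definition sp_pm (n : nat) (b : bool) := sp_char (hfin (xpm n b)).
Definition o_pm (n : nat) (b : bool) := o_char (hfin (xpm n b)).

(* Main.v *)
Require Import Defs.
From mathcomp Require Import all_boot all_order all_algebra.
From mathcomp Require Import perm qpoly mpoly zify ring.

Set Implicit Arguments.
Unset Strict Implicit.
Unset Printing Implicit Defensive.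

Import GRing.Theory.
Import Pdiv.CommonRing Pdiv.RingMonic.

Local Open Scope ring_scope.

(** Fix the r rows and the width c of the rectangle, and let x_1, ..., x_r be
    auxiliary variables, x_i lowering the index of h in row i by one.  Precisely,
    let L be the linear form that takes the monomial x^m to the product of the
    h_(c+r-1-m_i); it kills every monomial with an exponent at least c+r, so the
    x_i may be taken nilpotent [nilpotent_extension].  By Andreief's identity
    [andreief], L takes a product of alternants
    det(x_i^(m_j)) det(q_j(x_i)) to r! times the determinant of the values of the
    form at x^(m_i) q_j.  For m_i = c - nu_i + i (rows numbered from 0) this
    determinant is the Schur function, the symplectic or the orthogonal character
    of nu, according to whether q_j is x^(r-1-j), x^(r-1-j) + x^(r-1+j) (for
    j > 0) or x^(r-1-j) - x^(r+1+j).  By Weyl's denominator formulas [weyl_sp],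
    [weyl_o] the last two alternants of the q_j are the first one times
    prod_{i<j} (1 - x_i x_j), respectively times this and prod_i (1 - x_i^2).

    Hence (i) and (ii) for all p together are the images under L of the
    Littlewood identities
      sum t^oddcols(lambda) s_lambda
        = prod_i 1/(1 - t x_i) prod_{i<j} 1/(1 - x_i x_j),
      sum t^oddrows(lambda) s_lambda
        = prod_i (1 + t x_i)/(1 - x_i^2) prod_{i<j} 1/(1 - x_i x_j),
    lambda being the complement of nu in the rectangle: the factors in the
    denominators cancel against those of Weyl's formulas, and prod 1/(1 - t x_i),
    prod (1 + t x_i) are the generating functions of h_p and e_p, which produce
    the shapes on the left-hand sides [expdet_gf].

    The Littlewood identities are proved for alternants instead of Schur
    functions [colsum_littlewood, rowsum_littlewood].  Multiplying the first sum
    by prod (1 - t x_i) leaves, by telescoping, the partitions with even columns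
    [colsum_pairsum]; and the sum over even columns in the variables t, x_1, ...,
    x_r is prod (x_i - t) times the sum with weights t^oddcols in x_1, ..., x_r
    [pairsum_colsum].  The two facts give the even-column sum by induction on the
    number of variables.  For rows, prod (1 + t x_i) times the sum over even rows
    is the second sum [rowsum_even]; at t = 1 both sums run over all partitions
    with weight 1, which links the two cases.

    The resulting identities hold for every sequence h in a torsion-free ring
    [sp_rect, o_rect], which gives (i), (ii), (v) and the first case of (iii).
    The second case of (iii) follows because s_N does not change when a shape is
    replaced by its complement in a rectangle with N rows [schur_complement];
    this is read off from the quotient of alternants, as the alphabet is closed
    under inversion and has product 1.  For (iv), s_(2n+1) of a rectangle is the
    sum over p of the s_(2n) of the shapes in (i) [schur_branch_rect], so that (i)
    summed over p applies; for r > n the rectangle is first replaced by its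
    complement. *)

(** * Decreasing chains of natural numbers *)

(** Strict chains are the exponents of alternants, weak ones the monomials of
    complete symmetric functions; listing the largest entry first makes every
    sum over chains an iterated sum. *)
Fixpoint chains (weak : bool) (n a : nat) : seq (seq nat) :=
  if n is m.+1
  then flatten [seq [seq b :: l | l <- chains weak m (weak + b)] | b <- iota 0 a]
  else [:: [::]].

Lemma big_chains (V : nmodType) weak n a (g : seq nat -> V) :
  \sum_(l <- chains weak n.+1 a) g l =
  \sum_(0 <= b < a) \sum_(l <- chains weak n (weak + b)) g (b :: l).
Proof.
rewrite /= big_flatten big_map /index_iota subn0.
by apply: eq_bigr => b _; rewrite big_map.
Qed.

Lemma mem_chains weak n a (l : seq nat) : (l \in chains weak n a) =
  [&& size l == n, sorted (fun x y => y < weak + x)%N l & all (gtn a) l].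
Proof.
elim: n a l => [|n IH] a l; first by rewrite inE; case: l.
apply/flatten_mapP/idP => [[b]|].
  rewrite mem_iota /= add0n => ba /mapP [l' + ->].
  rewrite IH => /and3P [/eqP sl srt al].
  rewrite /= sl eqxx ba /= (path_min_sorted al) srt /=.
  by apply: sub_all al => x /= xb; case: weak {IH srt} xb => xb; lia.
case: l => [|b l] //= /and3P [/eqP [sl] srt /andP [ba al]].
exists b; first by rewrite mem_iota /= add0n.
apply/mapP; exists l => //; rewrite IH sl eqxx (path_sorted srt) /=.
by apply: order_path_min srt => x y z /=; case: weak {IH} => H1 H2; lia.
Qed.

Lemma chains_size weak n a l : l \in chains weak n a -> size l = n.
Proof. by rewrite mem_chains => /and3P [/eqP]. Qed.

Lemma uniq_chains weak n a : uniq (chains weak n a).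
Proof.
elim: n a => [|n IH] a //=.
elim: (iota 0 a) (iota_uniq 0 a) => //= b r IHr /andP [br ur].
rewrite cat_uniq map_inj_uniq ?IH ?IHr ?andbT //=; last by move=> x y [].
apply/hasPn => l /flatten_mapP [b' b'r /mapP [l' _ ->]].
by apply/mapP => -[l'' _ [Eb _]]; move: br; rewrite -Eb b'r.
Qed.

Lemma exchange_triangle (V : nmodType) a (G : nat -> nat -> V) :
  \sum_(0 <= b' < a) \sum_(0 <= b < b') G b b' =
  \sum_(0 <= b < a) \sum_(b.+1 <= b' < a) G b b'.
Proof.
elim: a => [|a IH]; first by rewrite !big_nil.
rewrite big_nat_recr //= IH [RHS]big_nat_recr //= [X in _ = _ + X]big_geq // addr0.
rewrite -big_split /= !big_nat; apply: eq_bigr => b /andP [_ ba].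
by rewrite big_nat_recr.
Qed.

(** A chain l_1 > ... > l_n of exponents belongs to the partition with parts
    l_k - (n - k), which has l_k - l_{k+1} - 1 columns of length k < n and l_n
    columns of length n.  The weight is the number of columns of odd length. *)
Fixpoint colweight (l : seq nat) : nat :=
  match l with
  | [::] => 0
  | [:: b] => b
  | b' :: b :: l' => (b' - b.+1) + colweight l'
  end.

(** The number of odd parts: the part attached to the head [b] is
    [b - size l']. *)
Fixpoint rowweight (l : seq nat) : nat :=
  if l is b :: l' then odd (b + size l') + rowweight l' else 0.

(** * Sums of alternating functions over chains *)
Section Chains.
Variables (K : comNzRingType) (V : lmodType K).
Implicit Types (phi : seq V -> K) (s : seq V) (u v : nat -> V).

(** Functions on lists, rather than on tuples, so that arguments can be
    prepended one at a time. *)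
Definition multilinear phi := forall s1 s2 a p q,
  phi (s1 ++ (a *: p + q) :: s2) = a * phi (s1 ++ p :: s2) + phi (s1 ++ q :: s2).
Definition alternating phi := forall s1 s2 s3 p,
  phi (s1 ++ p :: s2 ++ p :: s3) = 0.

(** The chain is read off from its largest entry while the arguments of [phi]
    are to be increasing, whence [catrev]; [s] holds the arguments that have
    already been fixed. *)
Definition chain_sum (w : seq nat -> K) phi u n a s :=
  \sum_(l <- chains false n a) w l * phi (catrev (map u l) s).

(** The sum over the partitions all of whose columns have even length: their
    exponents are consecutive pairs b, b+1, above a single 0 if [n] is odd.  A
    pair with b+1 = a is tolerated since in all uses its contribution
    vanishes. *)
Fixpoint pairsum phi v (n a : nat) s : K :=
  match n with
  | 0 => phi s
  | 1 => phi (v 0%N :: s)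
  | m.+2 => \sum_(0 <= b < a) pairsum phi v m b (v b :: v b.+1 :: s)
  end.

Lemma pairsumSS phi v n a s : pairsum phi v n.+2 a s =
  \sum_(0 <= b < a) pairsum phi v n b (v b :: v b.+1 :: s).
Proof. by []. Qed.

Lemma two_step_ind (P : nat -> Prop) :
  P 0 -> P 1 -> (forall n, P n -> P n.+2) -> forall n, P n.
Proof.
move=> P0 P1 PS n; suff [] : P n /\ P n.+1 by [].
by elim: n => // n [H1 H2]; split=> //; apply: PS.
Qed.

Local Notation colsum phi u t := (chain_sum (fun l => t ^+ colweight l) phi u).
Local Notation rowsum phi u t := (chain_sum (fun l => t ^+ rowweight l) phi u).

Lemma colsum0 phi u t a s : colsum phi u t 0 a s = phi s.
Proof. by rewrite /chain_sum big_seq1 mul1r. Qed.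

Lemma colsum1 phi u t a s :
  colsum phi u t 1 a s = \sum_(0 <= b < a) t ^+ b * phi (u b :: s).
Proof. by rewrite /chain_sum big_chains; apply: eq_bigr => b _; rewrite big_seq1. Qed.

Lemma colsumSS phi u t n a s :
  colsum phi u t n.+2 a s = \sum_(0 <= b < a) \sum_(b.+1 <= b' < a)
    t ^+ (b' - b.+1) * colsum phi u t n b (u b :: u b' :: s).
Proof.
rewrite -exchange_triangle /chain_sum big_chains; apply: eq_bigr => b' _.
rewrite big_chains; apply: eq_bigr => b _.
by rewrite big_distrr /=; apply: eq_bigr => l _; rewrite exprD mulrA.
Qed.

Lemma rowsum0 phi u t a s : rowsum phi u t 0 a s = phi s.
Proof. by rewrite /chain_sum big_seq1 mul1r. Qed.

Lemma rowsumS phi u t n a s :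
  rowsum phi u t n.+1 a s =
  \sum_(0 <= b < a) t ^+ odd (b + n) * rowsum phi u t n b (u b :: s).
Proof.
rewrite /chain_sum big_chains; apply: eq_bigr => b _.
rewrite big_distrr /= !big_seq; apply: eq_bigr => l /chains_size sl.
by rewrite exprD mulrA sl.
Qed.

Section Linear.
Variable phi : seq V -> K.
Hypotheses (lin : multilinear phi) (alt : alternating phi).

Lemma chain_sum_lin w u n a : multilinear (chain_sum w phi u n a).
Proof.
move=> s1 s2 c p q; rewrite /chain_sum big_distrr -big_split.
by apply: eq_bigr => l _ /=; rewrite !catrevE !catA lin mulrDr mulrCA.
Qed.

Lemma chain_sum_zero w u n a s :
  (forall s1, phi (s1 ++ s) = 0) -> chain_sum w phi u n a s = 0.
Proof. by move=> H; apply: big1 => l _; rewrite catrevE H mulr0. Qed.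

Lemma pairsum_lin v n a : multilinear (pairsum phi v n a).
Proof.
move: n a; apply: two_step_ind => [|a s1 s2 c p q|n IH a s1 s2 c p q] //=.
  exact: (lin (v 0%N :: s1)).
rewrite big_distrr -big_split; apply: eq_bigr => b _.
exact: (IH _ (_ :: _ :: s1)).
Qed.

Lemma pairsum_zero v n a s :
  (forall s1, phi (s1 ++ s) = 0) -> pairsum phi v n a s = 0.
Proof.
move: n a s; apply: two_step_ind => [a s|a s|n IH a s] H /=.
- exact: (H [::]).
- exact: (H [:: _]).
- by rewrite big1 // => b _; apply: IH => s1; rewrite -(cat_rcons _ _ (_ :: s)) -cat_rcons H.
Qed.

Lemma alt_tail s0 p s : phi (s0 ++ p :: p :: s) = 0.
Proof. exact: (alt s0 [::]). Qed.

(** With v_b = x^b, passing to v_b - t v_{b+1} multiplies an alternant by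
    prod (1 - t x), and this removes the partitions with odd columns.  The sum
    over the upper member of the topmost pair telescopes; it leaves v_{b+1} and
    a boundary term, killed by the hypothesis, and v_b, v_{b+1} fixed as the new
    tail satisfy that hypothesis for the chains below b. *)
Lemma colsum_pairsum v t n a s :
    (forall s1 s2, phi (s1 ++ v a :: s2 ++ s) = 0) ->
  colsum phi (fun b => v b - t *: v b.+1) t n a s = pairsum phi v n a s.
Proof.
set u := (fun b => v b - t *: v b.+1).
have linu b s1 s2 f (lf : multilinear f) :
    f (s1 ++ u b :: s2) = f (s1 ++ v b :: s2) - t * f (s1 ++ v b.+1 :: s2).
  by rewrite /u addrC -scaleNr lf mulNr addrC.
have teleu f (lf : multilinear f) d e s' : (d <= e)%N ->
    \sum_(d <= b < e) t ^+ (b - d) * f (u b :: s') =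
    f (v d :: s') - t ^+ (e - d) * f (v e :: s').
  move=> de; pose G b := t ^+ (b - d) * f (v b :: s').
  have -> : f (v d :: s') = G d by rewrite /G subnn mul1r.
  rewrite -[_ * _]/(G e) -opprB -telescope_sumr // -sumrN !big_nat.
  apply: eq_bigr => b /andP [db _].
  by rewrite (linu _ [::]) // /G subSn // exprSr /=; ring.
move: n a s; apply: two_step_ind => [a s H|a s H|n IH a s H] /=.
- exact: colsum0.
- rewrite colsum1; have := teleu phi lin 0%N a s (leq0n _).
  under eq_bigr do rewrite subn0.
  by move->; rewrite (H [::] [::]) mulr0 subr0.
rewrite colsumSS !big_nat; apply: eq_bigr => b /andP [_ ba].
pose f s' := colsum phi u t n b (u b :: s').
have lf : multilinear f.
  by move=> s1 s2 c p q; apply: (chain_sum_lin _ u n b (_ :: s1)).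
rewrite (teleu f lf) // {2}/f chain_sum_zero ?mulr0 ?subr0; last first.
  by move=> s1; rewrite -cat_rcons (H _ [::]).
rewrite /f (linu _ [::]) //; last exact: chain_sum_lin.
rewrite [X in _ - _ * X]chain_sum_zero ?mulr0 ?subr0 ?IH // => [s1 s2|s1].
- exact: alt.
- exact: alt_tail.
Qed.

Lemma rowsum_last v t n b s :
  rowsum phi v t n b.+1 (v b :: s) = rowsum phi v t n b (v b :: s).
Proof.
case: n => [|n]; first by rewrite !rowsum0.
rewrite !rowsumS big_nat_recr //= [X in _ + X](_ : _ = 0) ?addr0 //.
by rewrite chain_sum_zero ?mulr0 // => s1; apply: alt_tail.
Qed.

(** Raising some of the parts of a partition with even parts by one gives every
    partition exactly once, with a factor t for each odd part; choices that
    violate monotonicity vanish by alternation.  The weight base 0 on the left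
    keeps the partitions with even parts only.  As the largest entry of the raised chain can
    reach [a], the bound grows by one. *)
Lemma rowsum_even v t n a s : odd a = odd n ->
  rowsum phi (fun b => v b + t *: v b.+1) 0 n a s = rowsum phi v t n a.+1 s.
Proof.
set w := (fun b => v b + t *: v b.+1).
elim: n a s => [|n IH] a s par; first by rewrite !rowsum0.
rewrite !rowsumS; pose G b := rowsum phi v t n b (v b :: s).
have -> : \sum_(0 <= b < a) 0 ^+ odd (b + n) * rowsum phi w 0 n b (w b :: s) =
          \sum_(0 <= b < a) (odd b == odd n)%:R * (G b + t * G b.+1).
  apply: eq_bigr => b _; rewrite oddD.
  have [e|ne] := eqVneq (odd b) (odd n); last first.
    by move: ne; case: (odd b); case: (odd n) => //; rewrite /= expr1 !mul0r.
  rewrite e addbb expr0 !mul1r IH // /w addrC (chain_sum_lin _ v n b.+1 [::]) /=.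
  by rewrite rowsum_last addrC.
have G0 : odd n -> G 0%N = 0.
  by rewrite /G; case: (n) => // m; rewrite rowsumS big_geq.
(* The pairs b, b+1 with b of the parity of n tile all indices, except 0 when
   n is odd, where G vanishes. *)
suff: \sum_(0 <= b < a) (odd b == odd n)%:R * (G b + t * G b.+1) =
  \sum_(0 <= b < a + (odd a != odd n)) t ^+ odd (b + n) * G b.
  by move->; rewrite par /=; case: (odd n); rewrite addn1.
elim: a {par} => [|a IHa].
  rewrite big_geq // add0n /=; case: (boolP (odd n)) => on; last by rewrite big_geq.
  by rewrite big_nat1 G0 // mulr0.
rewrite big_nat_recr // IHa /=.
have [e|ne] := eqVneq (odd a) (odd n).
  have -> : (~~ odd a != odd n) by rewrite e; case: (odd n).
  rewrite /= mul1r addn0 addn1.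
  rewrite !big_nat_recr //= !oddD /= e addbb expr0 mul1r.
  by case: (odd n); rewrite /= ?expr1 addrA.
rewrite mul0r addr0 addn1.
have -> : ~~ odd a = odd n by move: ne; case: (odd a); case: (odd n).
by rewrite eqxx addn0.
Qed.

(** v_{b'} is congruent to t^(b'-d) v_d modulo the y_b with d <= b < b', and in
    each summand some v_d is already present: v_0 at the bottom, or the upper
    member of the topmost pair. *)
Lemma pairsum_shift v y t n b' s : (forall b, y b = v b.+1 - t *: v b) ->
  pairsum phi v n.+1 b' (v b' :: s) =
  \sum_(0 <= b < b') t ^+ (b' - b.+1) * pairsum phi v n.+1 b (y b :: s).
Proof.
move=> yE.
have tele f (lf : multilinear f) d e s' : (d <= e)%N ->
    f (v e :: s') = t ^+ (e - d) * f (v d :: s') +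
      \sum_(d <= b < e) t ^+ (e - b.+1) * f (y b :: s').
  move=> de; pose G b := t ^+ (e - b) * f (v b :: s').
  have -> : f (v e :: s') = G e by rewrite /G subnn mul1r.
  rewrite -[t ^+ _ * f (v d :: s')]/(G d) -[LHS](subrK (G d)) addrC.
  congr (_ + _); rewrite -telescope_sumr // !big_nat.
  apply: eq_bigr => b /andP [_ be].
  by rewrite yE [v b.+1 - _]addrC -scaleNr (lf [::]) /= /G -(subnSK be) exprS; ring.
case: n => [|n] /=.
  have lf : multilinear (fun s => phi (v 0%N :: s)).
    by move=> s1 s2; apply: (lin (_ :: s1)).
  by rewrite (tele _ lf 0%N) // (alt_tail [::]) mulr0 add0r.
transitivity (\sum_(0 <= d < b') \sum_(d.+1 <= b < b') t ^+ (b' - b.+1) *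
   pairsum phi v n d (v d :: v d.+1 :: y b :: s)); last first.
  by rewrite -exchange_triangle; apply: eq_bigr => b _; rewrite big_distrr.
rewrite !big_nat; apply: eq_bigr => d /andP [_ db].
have lf : multilinear (fun s => pairsum phi v n d (v d :: v d.+1 :: s)).
  by move=> s1 s2; apply: (pairsum_lin _ _ _ (_ :: _ :: s1)).
rewrite (tele _ lf d.+1) // pairsum_zero ?mulr0 ?add0r // => s1.
by rewrite -cat_rcons alt_tail.
Qed.
End Linear.

(** Read with [phi] an alternant in one more variable t: [good] columns vanish
    at t, and v_b takes the value t^b there.  Replacing every v by columns
    vanishing at t turns the pairs b, b+1 into gaps that are weighted by powers
    of t, which are the weights of odd columns. *)
Lemma pairsum_colsum phi psi v y t (good : pred V) n a s :
    multilinear phi -> alternating phi ->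
    (forall b, y b = v b.+1 - t *: v b) ->
    (forall b, good (y b)) ->
    (forall b s, all good s -> phi (v b :: s) = t ^+ b * psi s) ->
    all good s ->
  pairsum phi v n.+1 a s = colsum psi y t n a s.
Proof.
move=> lin alt yE yg pe; move: n a s; apply: two_step_ind => [a s gs|a s gs|n IH a s gs].
- by rewrite colsum0 /= pe // mul1r.
- rewrite colsum1 /=; apply: eq_bigr => b _.
  rewrite -(pe b) /= ?yg //.
  rewrite -[v b.+1](subrK (t *: v b)) -yE addrC.
  rewrite -[_ :: _]/([:: v b] ++ _ :: s) lin.
  by rewrite (alt_tail alt [::]) mulr0 add0r.
rewrite colsumSS -exchange_triangle pairsumSS; apply: eq_bigr => b' _.
rewrite -[v b'.+1](subrK (t *: v b')) -yE addrC.
rewrite -[v b' :: _ :: _]/([:: v b'] ++ _ :: s) (pairsum_lin lin) !cat1s.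
rewrite [X in _ * X]pairsum_zero ?mulr0 ?add0r; last by move=> s1; apply: alt_tail.
rewrite (pairsum_shift lin alt _ _ _ yE); apply: eq_bigr => b _.
by rewrite IH //= !yg gs.
Qed.

End Chains.

Notation colsum phi u t := (chain_sum (fun l => t ^+ colweight l) phi u).
Notation rowsum phi u t := (chain_sum (fun l => t ^+ rowweight l) phi u).

Section Consecutive.
Variables (K : comNzRingType) (V : lmodType K) (phi : seq V -> K).
Hypotheses (lin : multilinear phi) (alt : alternating phi).
Variables (v : nat -> V) (t : K).
Let w b := v b + t *: v b.+1.

Lemma lin_step s1 s2 b :
  phi (s1 ++ w b :: s2) = phi (s1 ++ v b :: s2) + t * phi (s1 ++ v b.+1 :: s2).
Proof. by rewrite /w addrC lin addrC. Qed.

(** From the top down, the term v_{b+1} of w_b repeats the next argument. *)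
Lemma consecutive_fill n s :
  phi (mkseq w n ++ v n :: s) = phi (mkseq v n ++ v n :: s).
Proof.
elim: n s => [|n IH] s //.
rewrite !mkseqS !cat_rcons lin_step.
by rewrite (alt_tail alt) mulr0 addr0 IH.
Qed.

(** Only the p topmost arguments can be shifted together; every other choice
    repeats an argument.  This is the expansion of prod (1 + t x) in elementary
    symmetric functions. *)
Lemma consecutive_shift n s :
  phi (mkseq w n ++ s) = \sum_(p < n.+1)
    t ^+ p * phi (mkseq v (n - p) ++ mkseq (fun i => v (n - p + i).+1) p ++ s).
Proof.
elim: n s => [|n IH] s; first by rewrite big_ord1 mul1r.
rewrite big_ord_recl expr0 mul1r [(n.+1 - _)%N]subn0 !mkseqS !cat_rcons lin_step.
rewrite consecutive_fill; congr (_ + _).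
rewrite IH big_distrr; apply: eq_bigr => p _.
have pn : (p <= n)%N by rewrite -ltnS.
by rewrite lift0 subSS mkseqS cat_rcons subnK // exprS /= mulrA.
Qed.
End Consecutive.

(** * Alternants *)
Section Alternant.
Variable K : comNzRingType.
Implicit Types (xs : seq K) (s : seq {poly K}).

(** Zero for lists of the wrong length, which makes it multilinear and
    alternating on all lists. *)
Definition alternant xs s : K :=
  if size s == size xs then
    \det (\matrix_(i < size xs, j < size xs) (s`_i).[xs`_j])
  else 0.

Lemma alternantE xs s : size s = size xs ->
  alternant xs s = \det (\matrix_(i < size xs, j < size xs) (s`_i).[xs`_j]).
Proof. by rewrite /alternant => ->; rewrite eqxx. Qed.

Lemma nth_cat_neq (T : Type) x0 (s1 s2 : seq T) x y i : i != size s1 ->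
  nth x0 (s1 ++ x :: s2) i = nth x0 (s1 ++ y :: s2) i.
Proof.
move=> ne; rewrite !nth_cat; case: ltnP => // le.
by rewrite -(@subnSK (size s1) i) // ltn_neqAle eq_sym ne.
Qed.

Lemma alternant_lin xs : multilinear (alternant xs).
Proof.
move=> s1 s2 a p q; rewrite /alternant !size_cat /=.
case: eqP => [e|_]; last by rewrite mulr0 addr0.
have i0P : (size s1 < size xs)%N by rewrite -e addnS ltnS leq_addr.
rewrite -[X in _ = _ + X]mul1r; apply: (determinant_multilinear (i0 := Ordinal i0P)).
- apply/rowP => j; rewrite !mxE /= !nth_cat ltnn subnn /=.
  by rewrite hornerD hornerZ mul1r.
- apply/matrixP => i j; rewrite !mxE (nth_cat_neq _ _ p (a *: p + q)) //.
  by rewrite -[size s1]/(val (Ordinal i0P)) eq_sym; apply: neq_lift.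
- apply/matrixP => i j; rewrite !mxE (nth_cat_neq _ _ q (a *: p + q)) //.
  by rewrite -[size s1]/(val (Ordinal i0P)) eq_sym; apply: neq_lift.
Qed.

Lemma alternant_alt xs : alternating (alternant xs).
Proof.
move=> s1 s2 s3 p; rewrite /alternant.
case: eqP => // e.
have lt2 : (size s1 + (size s2).+1 < size xs)%N.
  by rewrite -e !size_cat /= size_cat /= ltn_add2l !ltnS addnS ltnS leq_addr.
have lt1 : (size s1 < size xs)%N by apply: leq_ltn_trans lt2; apply: leq_addr.
apply: (determinant_alternate (i1 := Ordinal lt1) (i2 := Ordinal lt2)).
  by rewrite -val_eqE /= -[X in X != _]addn0 eqn_add2l.
move=> j; rewrite !mxE /= !nth_cat ltnn subnn /=.
rewrite ltnNge leq_addr /=.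
by rewrite addKn /= nth_cat ltnn subnn.
Qed.

Lemma alternant_map xs s psi :
  alternant xs (map ( *%R psi) s) = \prod_(x <- xs) psi.[x] * alternant xs s.
Proof.
rewrite /alternant size_map; case: eqP => [e|_]; last by rewrite mulr0.
rewrite (big_nth 0) big_mkord mulrC.
rewrite -[X in _ * X](_ : \det (diag_mx (\row_(j < size xs) psi.[xs`_j])) = _).
  rewrite -det_mulmx mul_mx_diag; congr determinant; apply/matrixP => i j.
  by rewrite !mxE (nth_map 0) ?e // hornerM mulrC.
by rewrite det_diag; apply: eq_bigr => j _; rewrite mxE.
Qed.

Lemma alternant_cons t xs f s : (forall g, g \in s -> g.[t] = 0) ->
  alternant (t :: xs) (f :: s) = f.[t] * alternant xs s.
Proof.
move=> gt; rewrite /alternant /= eqSS; case: eqP => [e|_]; last by rewrite mulr0.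
rewrite (expand_det_col _ ord0) big_ord_recl big1 ?addr0 => [|i _]; last first.
  by have g0 := gt _ (mem_nth 0 (_ : i < size s)%N); rewrite mxE /= g0 ?mul0r ?e.
rewrite mxE /=; congr (_ * _); rewrite /cofactor /= mul1r.
by congr determinant; apply/matrixP => i j; rewrite !mxE.
Qed.

Lemma alternant_vanish xs p s1 s2 : (forall x, x \in xs -> p.[x] = 0) ->
  alternant xs (s1 ++ p :: s2) = 0.
Proof.
move=> px; rewrite /alternant; case: eqP => // e.
have lt : (size s1 < size xs)%N by rewrite -e size_cat /= addnS ltnS leq_addr.
rewrite (expand_det_row _ (Ordinal lt)) big1 // => j _.
by rewrite mxE nth_cat ltnn subnn px ?mul0r // mem_nth.
Qed.

Lemma alternant_tri xs (p q : nat -> {poly K}) (a : nat -> K) (c : nat -> nat -> K) :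
    (forall i, (i < size xs)%N -> q i = a i *: p i + \sum_(k < i) c i k *: p k) ->
  alternant xs (mkseq q (size xs)) =
  \prod_(i < size xs) a i * alternant xs (mkseq p (size xs)).
Proof.
move=> qE; rewrite !alternantE ?size_mkseq //.
pose C := \matrix_(i < size xs, k < size xs)
  (if k == i then a i else if (k < i)%N then c i k else 0).
have -> : \prod_(i < size xs) a i = \det C.
  rewrite det_trig; first by apply: eq_bigr => i _; rewrite mxE eqxx.
  apply/is_trig_mxP => i j ij; rewrite mxE -val_eqE /= gtn_eqF // ltnNge ltnW //.
rewrite -det_mulmx; congr determinant; apply/matrixP => i j.
rewrite !mxE nth_mkseq // qE // hornerD hornerZ horner_sum (bigD1 i) //=.
rewrite !mxE eqxx nth_mkseq //; congr (_ + _).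
rewrite (big_ord_widen_cond (size xs) xpredT (fun k => (c i k *: p k).[xs`_j]));
  last exact: ltnW.
rewrite big_mkcond [RHS]big_mkcond; apply: eq_bigr => k _ /=.
rewrite !mxE nth_mkseq // -val_eqE /=; case: eqVneq => [->|_] /=; first by rewrite ltnn.
by case: ltnP => _; rewrite ?mul0r // hornerZ.
Qed.

Lemma alternant_unitri xs (p q : nat -> {poly K}) (c : nat -> nat -> K) :
    (forall i, (i < size xs)%N -> q i = p i + \sum_(k < i) c i k *: p k) ->
  alternant xs (mkseq q (size xs)) = alternant xs (mkseq p (size xs)).
Proof.
move=> qE; rewrite (alternant_tri (p := p) (a := fun=> 1) (c := c)).
  by rewrite big1 ?mul1r.
by move=> i /qE ->; rewrite scale1r.
Qed.
End Alternant.

Lemma alternant_morph (K K' : comNzRingType) (f : {rmorphism K -> K'}) xs s :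
  alternant (map f xs) (map (map_poly f) s) = f (alternant xs s).
Proof.
rewrite /alternant !size_map; case: eqP => [e|_]; last by rewrite rmorph0.
rewrite -det_map_mx; congr determinant; apply/matrixP => i j.
by rewrite !mxE (nth_map 0) ?e // (nth_map 0) // horner_map.
Qed.

Fixpoint prod_pairs (K : comNzRingType) (f : K -> K -> K) (xs : seq K) : K :=
  if xs is t :: xs' then \prod_(x <- xs') f t x * prod_pairs f xs' else 1.

(** * Littlewood identities in nilpotent variables *)
Section Littlewood.
Variable K : comNzRingType.
Implicit Types (xs : seq K).
Local Notation monom := (fun b : nat => 'X^b : {poly K}).

Lemma horner_Xsub (t x : K) : ('X - t%:P).[x] = x - t.
Proof. by rewrite !hornerE. Qed.

Lemma chain_sum_scale w xs (psi : {poly K}) (v u : nat -> {poly K}) n a :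
  (forall b, u b = psi * v b) ->
  chain_sum w (alternant xs) u n a [::] =
  \prod_(x <- xs) psi.[x] * chain_sum w (alternant xs) v n a [::].
Proof.
move=> uE; rewrite /chain_sum big_distrr /=; apply: eq_bigr => l _.
rewrite [RHS]mulrCA -alternant_map !catrevE !cats0 map_rev -map_comp.
by congr (_ * alternant _ (rev _)); apply: eq_map => b; rewrite /= uE.
Qed.

Lemma colsum_pairsum_monom xs t n a : (forall x, x \in xs -> x ^+ a = 0) ->
  \prod_(x <- xs) (1 - t * x) * colsum (alternant xs) monom t n a [::] =
  pairsum (alternant xs) monom n a [::].
Proof.
move=> nil.
rewrite -(colsum_pairsum (@alternant_lin _ _) (@alternant_alt _ _) t n); last first.
  move=> s1 s2; rewrite cats0; apply: alternant_vanish => x xx.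
  by rewrite hornerXn nil.
rewrite (@chain_sum_scale _ xs (1 - t *: 'X) monom (fun b => 'X^b - t *: 'X^(b.+1))).
  by congr (_ * _); apply: eq_bigr => x _; rewrite !hornerE.
by move=> b; rewrite mulrBl mul1r exprS scalerAl.
Qed.

Lemma alternant_vandermonde t xs :
  alternant (t :: xs) (mkseq monom (size xs).+1) =
  \prod_(x <- xs) (x - t) * alternant xs (mkseq monom (size xs)).
Proof.
pose q b : {poly K} := if b is b'.+1 then ('X - t%:P) * 'X^b' else 1.
rewrite -(@alternant_unitri _ (t :: xs) monom q
  (fun i k => if k == i.-1 then - t else 0)); last first.
  case=> [_|i li]; first by rewrite big_ord0 addr0.
  rewrite big_ord_recr /= eqxx big1 => [|k _]; last first.
    by rewrite ltn_eqF // scale0r.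
  by rewrite add0r mulrBl exprS mul_polyC scaleNr.
rewrite /mkseq /= -add1n iotaDl -map_comp alternant_cons; last first.
  by move=> g /mapP [b _ ->]; rewrite /= hornerM horner_Xsub subrr mul0r.
have -> : (1 : {poly K}).[t] = 1 by rewrite hornerE.
rewrite mul1r -(eq_map (f := ( *%R ('X - t%:P)) \o monom)) // map_comp alternant_map.
by congr (_ * _); apply: eq_bigr => x _; rewrite horner_Xsub.
Qed.

(** Littlewood's identity sum s_lambda = prod_{i<j} 1 / (1 - x_i x_j) over the
    partitions with columns of even length, multiplied by its
    denominators and by the Vandermonde determinant.  A new variable t enters
    through the weights t^(odd columns), which (1 - t x) removes again. *)
Lemma pairsum_littlewood B xs : (forall x, x \in xs -> x ^+ B = 0) ->
  prod_pairs (fun x y => 1 - x * y) xs * pairsum (alternant xs) monom (size xs) B [::] =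
  alternant xs (mkseq monom (size xs)).
Proof.
elim: xs => [|t xs IH] nil; first by rewrite mul1r.
rewrite [prod_pairs _ _]/= [size (t :: xs)]/=.
have nil' x : x \in xs -> x ^+ B = 0 by move=> xx; rewrite nil // inE xx orbT.
rewrite alternant_vandermonde -IH //.
rewrite (@pairsum_colsum _ _ (alternant (t :: xs)) (alternant xs) monom
  (fun b => ('X - t%:P) * 'X^b) t (fun g => g.[t] == 0)) //.
- rewrite (@chain_sum_scale _ xs ('X - t%:P) monom) // -(@colsum_pairsum_monom _ t) //.
  under [\prod_(x <- xs) _.[x]]eq_bigr do rewrite horner_Xsub.
  by rewrite [RHS]mulrCA mulrACA mulrCA [in RHS]mulrCA !mulrA; congr (_ * _); ring.
- exact: alternant_lin.
- exact: alternant_alt.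
- by move=> b; rewrite mulrBl exprS mul_polyC.
- by move=> b; rewrite hornerM horner_Xsub subrr mul0r.
- by move=> b s /allP gs; rewrite alternant_cons ?hornerXn // => g /gs /eqP.
Qed.

Lemma nilp_inv xs t B : (forall x, x \in xs -> x ^+ B = 0) ->
  exists D, D * \prod_(x <- xs) (1 - t * x) = 1.
Proof.
elim: xs => [|x s IH] nil; first by exists 1; rewrite big_nil mulr1.
have [|D eD] := IH; first by move=> y ys; rewrite nil // inE ys orbT.
have e1 : (1 - t * x) * \sum_(i < B) (t * x) ^+ i = 1.
  rewrite -[1 - _]opprB mulNr -subrX1 exprMn (nil x) ?mem_head // mulr0.
  by rewrite sub0r opprK.
exists (D * \sum_(i < B) (t * x) ^+ i).
rewrite big_cons mulrACA mulrC [X in _ * X]mulrC mulrACA [X in X * _]mulrC.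
by rewrite e1 mul1r mulrC.
Qed.

(** The sum over p of t^p h_p times the Vandermonde determinant is an alternant
    with a single modified exponent, and is determined by its product with
    prod (1 - t x). *)
Lemma colsum_littlewood xs t c : (0 < size xs)%N ->
    (forall x, x \in xs -> x ^+ (c + size xs) = 0) ->
  prod_pairs (fun x y => 1 - x * y) xs *
    colsum (alternant xs) monom t (size xs) (c + size xs) [::] =
  \sum_(p < c.+1) t ^+ p *
    alternant xs (mkseq monom (size xs).-1 ++ [:: 'X^((size xs).-1 + p)]).
Proof.
case: xs => // x0 xs' _; set xs := x0 :: xs' => nil.
have [D' eD] := nilp_inv t nil; set D := \prod_(_ <- _) _ in eD.
apply: (can_inj (f := *%R D) (g := *%R D')) => [y|]; first by rewrite mulrA eD mul1r.
rewrite mulrCA colsum_pairsum_monom // pairsum_littlewood //.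
have linA := @alternant_lin K xs; have altA := @alternant_alt K xs.
pose n' := size xs'; pose u b : {poly K} := 'X^b + (- t) *: 'X^(b.+1).
pose f z := alternant xs (mkseq u n' ++ [:: z]).
have Df p : D * alternant xs (mkseq monom n' ++ [:: 'X^(n' + p)]) = f (u (n' + p)%N).
  have uE b : (1 - t *: 'X) * 'X^b = u b.
    by rewrite mulrBl mul1r -scalerAl -exprS /u scaleNr.
  have -> : D = \prod_(x <- xs) (1 - t *: 'X).[x].
    by apply: eq_bigr => x _; rewrite !hornerE.
  rewrite -alternant_map map_cat -map_comp /= uE /f.
  by congr (alternant _ (_ ++ _)); apply: eq_map => b; apply: uE.
have fu b : f (u b) = f 'X^b - t * f 'X^(b.+1).
  by rewrite /f (lin_step linA (monom)) mulNr.
rewrite big_distrr /=.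
under eq_bigr => p _ do rewrite mulrCA Df fu.
rewrite -(big_mkord xpredT (fun p => t ^+ p * (f 'X^(n' + p) - t * f 'X^((n' + p).+1)))).
pose G p := t ^+ p * f 'X^(n' + p).
have -> : alternant xs (mkseq monom (size xs)) = G 0%N - G c.+1.
  rewrite /G {2}/f alternant_vanish ?mulr0 ?subr0 => [|x xx]; last first.
    by rewrite hornerXn addnC addSnnS; apply: nil.
  by rewrite mul1r addn0 /f (consecutive_fill linA altA monom) cats1 -mkseqS.
rewrite -opprB -telescope_sumr // -sumrN; apply: eq_bigr => p _.
by rewrite /G addnS exprSr; ring.
Qed.

(** Reduced to the column version through t = 1, where both weights are 1: if E
    is the sum over even parts, prod (1 + x) E = sum over all partitions, and
    prod (1 - x) times the latter is the sum over even columns. *)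
Lemma rowsum_littlewood xs t c :
    (forall x, x \in xs -> x ^+ (c + size xs) = 0) ->
  \prod_(x <- xs) (1 - x ^+ 2) * prod_pairs (fun x y => 1 - x * y) xs *
    rowsum (alternant xs) monom t (size xs) (c + size xs) [::] =
  \sum_(p < (size xs).+1) t ^+ p *
    alternant xs (mkseq monom (size xs - p) ++
             mkseq (fun i => 'X^((size xs - p + i).+1)) p).
Proof.
move=> nil; set n := size xs; set P := prod_pairs _ _.
have linA := @alternant_lin K xs; have altA := @alternant_alt K xs.
have van b : (c + n <= b)%N -> forall s1 s2, alternant xs (s1 ++ 'X^b :: s2) = 0.
  move=> le s1 s2; apply: alternant_vanish => x xx.
  by rewrite hornerXn -(subnK le) exprD nil // mulr0.
have stab t' a : rowsum (alternant xs) monom t' n (c + n + a) [::] =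
                 rowsum (alternant xs) monom t' n (c + n) [::].
  elim: a => [|a <-]; first by rewrite addn0.
  rewrite addnS; case: (n) van => [|m] van; first by rewrite !rowsum0.
  rewrite !rowsumS big_nat_recr //= chain_sum_zero ?mulr0 ?addr0 // => s1.
  by apply: van; apply: leq_addr.
(* The bound must have the parity of n for [rowsum_even]; by [stab] it may be
   enlarged freely. *)
pose a := (c + n + odd c)%N; pose E' := rowsum (alternant xs) monom 0 n a [::].
have para : odd a = odd n by rewrite /a !oddD addbAC; case: (odd c).
pose w t' b : {poly K} := 'X^b + t' *: 'X^(b.+1).
have wE t' b : w t' b = (1 + t' *: 'X) * 'X^b.
  by rewrite mulrDl mul1r -scalerAl -exprS.
have FE t' : rowsum (alternant xs) monom t' n (c + n) [::] =
             \prod_(x <- xs) (1 + t' *: 'X).[x] * E'.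
  rewrite -(stab t' (odd c).+1) addnS -(rowsum_even linA altA _ _ _ para).
  exact: (chain_sum_scale _ _ _ _ (wE t')).
have E'E : \prod_(x <- xs) (1 - x ^+ 2) * E' = pairsum (alternant xs) monom n (c + n) [::].
  rewrite -(@colsum_pairsum_monom _ 1) //.
  have -> : colsum (alternant xs) monom 1 n (c + n) [::] =
            rowsum (alternant xs) monom 1 n (c + n) [::].
    by apply: eq_bigr => l _; rewrite !expr1n.
  rewrite FE mulrA -big_split /=; congr (_ * _); apply: eq_bigr => x _.
  by rewrite !hornerE; ring.
rewrite FE mulrCA [X in _ * X]mulrAC E'E [X in _ * X]mulrC pairsum_littlewood //.
transitivity (alternant xs (mkseq (w t) n ++ [::])).
  rewrite -alternant_map cats0 -map_comp.
  by congr alternant; apply: eq_map => b; rewrite /= -wE.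
rewrite (consecutive_shift linA altA); apply: eq_bigr => p _.
by rewrite cats0.
Qed.

End Littlewood.

(** * Weyl denominators *)

(** Expansion of an alternant along a new variable t after replacing its columns
    by ones that vanish at t.  The replacement multiplies the alternant by a
    power of t, so t has to be regular. *)
Lemma alternant_peel_reg (K : comNzRingType) (t : K) xs
    (C' C : nat -> {poly K}) psi (d : nat -> nat -> K) :
    GRing.lreg t -> psi.[t] = 0 -> (C' 0%N).[t] = t ^+ size xs ->
    (forall j, (j < size xs)%N ->
       psi * C j = t *: C' j.+1 + \sum_(k < j.+1) d j k *: C' k) ->
  alternant (t :: xs) (mkseq C' (size xs).+1) =
  \prod_(x <- xs) psi.[x] * alternant xs (mkseq C (size xs)).
Proof.
move=> rt pt C0 CE; apply: (lregX (n := size xs) rt).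
pose q i : {poly K} := if i is j.+1 then psi * C j else C' 0%N.
have := @alternant_tri _ (t :: xs) C' q (fun i => if i is _.+1 then t else 1)
  (fun i k => d i.-1 k).
rewrite big_ord_recl mul1r prodr_const card_ord => <- => [|[_|j jn]]; last first.
- exact: CE.
- by rewrite big_ord0 addr0 scale1r.
rewrite -C0 -alternant_map -alternant_cons.
  rewrite /mkseq /= -add1n iotaDl -!map_comp.
  by congr (alternant _ (_ :: _)); apply: eq_map.
by move=> g /mapP [h _ ->]; rewrite hornerM pt mul0r.
Qed.

(** A nilpotent t is the value at 0 of the monic, hence regular, polynomial
    X + t, so for columns defined over every ring regularity can be dropped. *)
Lemma alternant_peel (K : comNzRingType) (t : K) xs
    (C' C : forall L : comNzRingType, nat -> {poly L})
    (psi : forall L : comNzRingType, L -> {poly L})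
    (d : forall L : comNzRingType, L -> nat -> nat -> L) :
    (forall (L M : comNzRingType) (f : {rmorphism L -> M}),
       [/\ forall j, map_poly f (C' L j) = C' M j,
           forall j, map_poly f (C L j) = C M j
         & forall a, map_poly f (psi L a) = psi M (f a)]) ->
    (forall (L : comNzRingType) (a : L),
       [/\ (psi L a).[a] = 0, (C' L 0%N).[a] = a ^+ size xs
         & forall j, (j < size xs)%N ->
           psi L a * C L j =
           a *: C' L j.+1 + \sum_(k < j.+1) d L a j k *: C' L k]) ->
  alternant (t :: xs) (mkseq (C' K) (size xs).+1) =
  \prod_(x <- xs) (psi K t).[x] * alternant xs (mkseq (C K) (size xs)).
Proof.
move=> nat CE; pose t' : {poly K} := 'X + t%:P; pose xs' := map polyC xs.
pose f : {rmorphism {poly K} -> K} := horner_eval (0 : K).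
have fC x : f x%:P = x by rewrite /f /= horner_evalE hornerC.
have f0 : f t' = t by rewrite /f /= /t' horner_evalE !hornerE.
have fxs : map f xs' = xs.
  rewrite -map_comp -[RHS]map_id; apply: eq_map => x; exact: fC.
have sxs : size xs' = size xs by rewrite size_map.
have [pt C0 CE'] := CE {poly K} t'.
have := @alternant_peel_reg _ t' xs' (C' _) (C _) (psi _ t') (d _ t').
rewrite sxs => /(_ _ pt C0 CE') E.
have {E} := congr1 f (E (monic_lreg (monicXaddC t))).
have [nC' nC npsi] := nat _ _ f.
rewrite [RHS]rmorphM [X in _ = X * _]rmorph_prod -!alternant_morph map_cons fxs f0.
rewrite /mkseq -!map_comp (eq_map (nC' : _ =1 _)) (eq_map (nC : _ =1 _)) => ->.
rewrite big_map; congr (_ * _); apply: eq_bigr => x _.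
by rewrite -horner_map npsi f0 fC.
Qed.

(** After x := 1/z and multiplication by x^(n-1), these are the columns z^j,
    z^j + z^-j (halved for j = 0) and z^j - z^(-j-2) of the Jacobi--Trudi
    determinants, z being the shift of the index of h. *)
Definition col_s (n : nat) (K : comNzRingType) (j : nat) : {poly K} :=
  'X^(n - j.+1).
Definition col_sp (n : nat) (K : comNzRingType) (j : nat) : {poly K} :=
  'X^(n - j.+1) + if j == 0%N then 0 else 'X^(n.-1 + j).
Definition col_o (n : nat) (K : comNzRingType) (j : nat) : {poly K} :=
  'X^(n - j.+1) - 'X^(n + j.+1).

Section Weyl.
Variable K : comNzRingType.
Implicit Types (xs : seq K) (t : K).

Lemma alternant_col_s t xs :
  alternant (t :: xs) (mkseq (@col_s (size xs).+1 K) (size xs).+1) =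
  \prod_(x <- xs) (t - x) * alternant xs (mkseq (@col_s (size xs) K) (size xs)).
Proof.
rewrite (alternant_peel t (C := col_s (size xs)) (psi := fun L a => a%:P - 'X)
  (d := fun L a j k => - (k == j)%:R)).
- by congr (_ * _); apply: eq_bigr => x _; rewrite !hornerE.
- move=> L M f; split=> [j|j|a]; rewrite ?map_polyXn //.
  by rewrite rmorphB /= map_polyC map_polyX.
move=> L a; split=> [||j jn]; rewrite /col_s.
- by rewrite !hornerE subrr.
- by rewrite subn1 hornerXn.
rewrite big_ord_recr /= eqxx big1 => [|k _]; last by rewrite ltn_eqF // oppr0 scale0r.
by rewrite add0r !subSS scaleN1r mulrBl mul_polyC -exprS subnSK.
Qed.

(** (t - x)(1 - t x) = t (1 + x^2) - (1 + t^2) x, and multiplication by 1 + x^2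
    acts on the columns like multiplication by z + 1/z. *)
Lemma alternant_col_sp t xs :
  alternant (t :: xs) (mkseq (@col_sp (size xs).+1 K) (size xs).+1) =
  \prod_(x <- xs) ((t - x) * (1 - t * x)) *
  alternant xs (mkseq (@col_sp (size xs) K) (size xs)).
Proof.
rewrite (alternant_peel t (C := col_sp (size xs))
  (psi := fun L a => a *: (1 + 'X^2) - (1 + a ^+ 2) *: 'X)
  (d := fun L a j k => if k == j then - (1 + a ^+ 2)
     else if k.+1 == j then (if k == 0%N then a *+ 2 else a) else 0)).
- by congr (_ * _); apply: eq_bigr => x _; rewrite !hornerE; ring.
- move=> L M f; split=> [j|j|a]; rewrite /col_sp.
  + by rewrite rmorphD /= map_polyXn; case: eqP => _; rewrite ?rmorph0 ?map_polyXn.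
  + by rewrite rmorphD /= map_polyXn; case: eqP => _; rewrite ?rmorph0 ?map_polyXn.
  rewrite rmorphB /= !map_polyZ /= rmorphD rmorph1 /= map_polyXn map_polyX.
  by rewrite rmorphD rmorph1 rmorphXn.
move=> L a; split=> [||[|j] jn]; rewrite /col_sp.
- by rewrite !hornerE; ring.
- by rewrite subn1 addr0 hornerXn.
- rewrite big_ord_recr /= big_ord0 add0r subn1 !addr0 !subSS /= subn1 addn1.
  case: (size xs) jn => // n _; rewrite !exprS /= -!mul_polyC.
  by rewrite polyCN polyCD polyC1; ring.
rewrite !big_ord_recr /= eqxx big1 => [|k _]; last first.
  have kj := ltn_ord k.
  by rewrite (ltn_eqF (ltnW (kj : k.+1 < j.+1)%N)) eqSS (ltn_eqF kj) scale0r.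
rewrite add0r (ltn_eqF (ltnSn j)) -!mul_polyC !subSS.
have [m ->] : exists m, size xs = (m + j.+2)%N by exists (size xs - j.+2)%N; rewrite subnK.
rewrite addnK (_ : (m + j.+2 - j.+1 = m + 1)%N); last by lia.
rewrite (_ : (m + j.+2 - j = m + 2)%N); last by lia.
rewrite (_ : ((m + j.+2).-1 + j.+1 = m + j.*2 + 2)%N); last by lia.
rewrite (_ : (m + j.+2 + j.+2 = m + j.*2 + 4)%N); last by lia.
rewrite (_ : (m + j.+2 + j.+1 = m + j.*2 + 3)%N); last by lia.
rewrite (_ : (m + j.+2 + j = m + j.*2 + 2)%N); last by lia.
rewrite !exprD polyCN polyCD polyC1 rmorphXn /=.
case: j jn => [|j] jn /=; rewrite ?rmorphMn /= ?double0 ?expr0;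
  by move: (a%:P) => b; ring.
Qed.

Theorem weyl_sp xs :
  alternant xs (mkseq (@col_sp (size xs) K) (size xs)) =
  prod_pairs (fun x y => 1 - x * y) xs *
  alternant xs (mkseq (@col_s (size xs) K) (size xs)).
Proof.
elim: xs => [|t xs IH]; first by rewrite mul1r /mkseq.
rewrite alternant_col_sp alternant_col_s IH big_split /=.
by rewrite [RHS]mulrACA [X in _ = X * _]mulrC.
Qed.

(** (1 - x^2) (z^j + z^-j) is the difference of the orthogonal columns j and
    j - 2. *)
Theorem weyl_o xs :
  alternant xs (mkseq (@col_o (size xs) K) (size xs)) =
  \prod_(x <- xs) (1 - x ^+ 2) *
  alternant xs (mkseq (@col_sp (size xs) K) (size xs)).
Proof.
have -> : \prod_(x <- xs) (1 - x ^+ 2) = \prod_(x <- xs) (1 - 'X^2).[x].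
  by apply: eq_bigr => x _; rewrite !hornerE.
rewrite -alternant_map -map_comp.
apply/esym/(@alternant_unitri _ xs (@col_o (size xs) K) _
  (fun i k => - (k.+2 == i)%:R)) => i li; rewrite /= /col_sp /col_o.
have [n sn] : exists n, size xs = (n + i.+1)%N by exists (size xs - i.+1)%N; rewrite subnK.
rewrite sn; case: i li sn => [|[|i]] li sn.
- rewrite big_ord0 !addr0 /= !subn1 !addn1 /= !exprS; ring.
- rewrite big_ord1 oppr0 scale0r addr0 /= !addn2 !addn1 /= !subSS subn0 !exprS; ring.
rewrite !big_ord_recr /= !eqSS eqxx scaleN1r (gtn_eqF (ltnSn i)) oppr0 scale0r.
rewrite addr0 big1 ?add0r => [|k _]; last first.
  by rewrite !eqSS ltn_eqF // oppr0 scale0r.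
rewrite addnK.
rewrite (_ : (n + i.+3 - i.+1 = n + 2)%N); last by lia.
rewrite (_ : (n + i.+3 + i.+3 = n + i.*2 + 6)%N); last by lia.
rewrite (_ : ((n + i.+3).-1 + i.+2 = n + i.*2 + 4)%N); last by lia.
rewrite (_ : (n + i.+3 + i.+1 = n + i.*2 + 4)%N); last by lia.
by rewrite !exprD; ring.
Qed.
End Weyl.

(** * From alternants to Jacobi--Trudi determinants *)
Definition coef_form (R : comNzRingType) (g : nat -> R) (B : nat) (f : {poly R}) : R :=
  \sum_(k < B) f`_k * g k.

(** The tensor power of R[X]/(X^B) with the form X^k -> g_k in each factor,
    built by adjoining one variable at a time.  Nilpotency makes the sums over
    all partitions finite. *)
Lemma nilpotent_extension (R : comNzRingType) (g : nat -> R) (B n : nat) :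
  (0 < B)%N ->
  exists (K : comNzRingType) (emb : {rmorphism R -> K}) (xs : seq K) (L : K -> R),
  [/\ size xs = n, forall x, x \in xs -> x ^+ B = 0,
      forall a u v, L (emb a * u + v) = a * L u + L v
    & forall f : nat -> {poly R},
        L (\prod_(i < n) (map_poly emb (f i)).[xs`_i]) =
        \prod_(i < n) coef_form g B (f i)].
Proof.
move=> B0; elim: n => [|n [K [emb [xs [L [sxs nil lin Lf]]]]]].
  exists R, idfun, [::], id; split=> // f.
  by rewrite !big_ord0.
have L0 : L 0 = 0 by have := lin (-1) 0 0; rewrite mulr0 addr0 mulN1r addNr.
have LD u v : L (u + v) = L u + L v by have := lin 1 u v; rewrite rmorph1 !mul1r.
have LZ a u : L (emb a * u) = a * L u by rewrite -[_ * u]addr0 lin L0 addr0.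
pose h : {poly K} := 'X^B; pose q : {rmorphism {poly K} -> {poly %/ h}} := in_qpoly h.
have hE : mk_monic h = 'X^B by rewrite mk_monic_Xn prednK.
have coefq p k : (k < B)%N -> (q p : {poly K})`_k = p`_k.
  by move=> kB; rewrite /= hE -take_poly_rmodp coef_take_poly kB.
pose C : {rmorphism K -> {poly K}} := polyC.
pose L' (u : {poly %/ h}) := \sum_(k < B) L (u : {poly K})`_k * g k.
have embE a : q (emb a)%:P = (q \o C \o emb) a by [].
exists {poly %/ h}, (q \o C \o emb), (q 'X :: map (q \o C) xs), L'.
split=> [|x|a u v|f].
- by rewrite /= size_map sxs.
- rewrite inE => /orP [/eqP ->|/mapP [y /nil ey ->]]; last by rewrite -rmorphXn ey rmorph0.
  rewrite -rmorphXn; apply/val_inj/polyP => k /=.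
  rewrite hE -take_poly_rmodp coef_take_poly coefXn.
  by rewrite coef0; case: ltnP => // kB; rewrite ltn_eqF.
- have -> : (q \o C \o emb) a * u = emb a *: u.
    apply: val_inj; rewrite /= rmodp_mulml ?monic_mk_monic // mul_polyC.
    by rewrite rmodp_small // (leq_ltn_trans (size_scale_leq _ _)) ?size_mk_monic.
  rewrite /L' big_distrr -big_split; apply: eq_bigr => k _ /=.
  by rewrite coefD coefZ lin mulrDl mulrA.
pose a := \prod_(i < n) (map_poly emb (f i.+1)).[xs`_i].
have -> : \prod_(i < n.+1)
    (map_poly (q \o C \o emb) (f i)).[(q 'X :: map (q \o C) xs)`_i] =
  q (a *: map_poly emb (f 0%N)).
  rewrite big_ord_recl -mul_polyC mulrC rmorphM; congr (_ * _).
    rewrite /a -[a%:P]/(C a) !rmorph_prod; apply: eq_bigr => i _.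
    rewrite lift0 [nth 0 _ i.+1]/= (nth_map 0) ?sxs // -[q (C _)]/((q \o C) _).
    rewrite -horner_map; congr horner.
    by apply/polyP => k; rewrite !coef_map.
  rewrite [nth 0 _ _]/= -[map_poly emb _]comp_polyXr -horner_map.
  by congr horner; apply/polyP => k; rewrite !coef_map.
rewrite big_ord_recl mulrC.
have -> : \prod_(i < n) coef_form g B (f (lift ord0 i)) = L a.
  by rewrite (Lf (fun i => f i.+1)); apply: eq_bigr.
rewrite /L' /coef_form big_distrr; apply: eq_bigr => k _.
by rewrite coefq // coefZ coef_map [a * _]mulrC LZ /=; ring.
Qed.

Section Andreief.
Variables (R K : comNzRingType) (emb : {rmorphism R -> K}) (xs : seq K).
Variables (L : K -> R) (g : nat -> R) (B : nat).
Hypothesis lin : forall a u v, L (emb a * u + v) = a * L u + L v.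
Hypothesis Lf : forall f : nat -> {poly R},
  L (\prod_(i < size xs) (map_poly emb (f i)).[xs`_i]) =
  \prod_(i < size xs) coef_form g B (f i).

Lemma L_sum (I : Type) (r : seq I) (a : I -> R) (u : I -> K) :
  L (\sum_(i <- r) emb (a i) * u i) = \sum_(i <- r) a i * L (u i).
Proof.
elim: r => [|i r IH]; last by rewrite !big_cons lin IH.
by rewrite !big_nil; have := lin (-1) 0 0; rewrite mulr0 addr0 mulN1r addNr.
Qed.

Lemma L_prod (f : 'I_(size xs) -> {poly R}) :
  L (\prod_(i < size xs) (map_poly emb (f i)).[xs`_i]) =
  \prod_(i < size xs) coef_form g B (f i).
Proof.
pose f' i : {poly R} := if insub i is Some j then f j else 0.
have f'E (i : 'I_(size xs)) : f i = f' i by rewrite /f' valK.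
under eq_bigr do rewrite f'E; rewrite Lf.
by apply: eq_bigr => i _; rewrite -f'E.
Qed.

(** Andreief's identity.  The factorial is the price for symmetrizing: the form
    L does not see the order of the variables. *)
Lemma andreief (p q : nat -> {poly R}) (n := size xs) :
  L (alternant xs (mkseq (fun i => map_poly emb (p i)) n) *
     alternant xs (mkseq (fun j => map_poly emb (q j)) n)) =
  \det (\matrix_(i < n, j < n) coef_form g B (p i * q j)) *+ n`!.
Proof.
set M := \matrix_(_, _) _.
rewrite !alternantE ?size_mkseq // -[X in X * _]det_tr -[X in _ * X]det_tr.
rewrite {1}/determinant big_distrl /=.
transitivity (L (\sum_(s : 'S_n) \sum_(t : 'S_n) emb ((-1) ^+ s * (-1) ^+ t) *
   \prod_(i < n) (map_poly emb (p (s i) * q (t i))).[xs`_i])).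
  congr L; apply: eq_bigr => s _; rewrite /determinant big_distrr /=.
  apply: eq_bigr => t _; rewrite mulrACA rmorphM !rmorph_sign -big_split /=.
  by congr (_ * _); apply: eq_bigr => i _; rewrite !mxE !nth_mkseq // rmorphM hornerM.
rewrite pair_big /= L_sum -(pair_big xpredT xpredT (fun s t : 'S_n =>
  (-1) ^+ s * (-1) ^+ t *
  L (\prod_(i < n) (map_poly emb (p (s i) * q (t i))).[xs`_i]))) /=.
rewrite -(card_Sn n) -sumr_const; apply: eq_big => [s|s _] //.
under eq_bigr => t _ do rewrite L_prod.
have detM : \det (row_perm s M) = (-1) ^+ s * \det M.
  by rewrite row_permE det_mulmx det_perm.
rewrite -[RHS](signrMK s) -detM [in RHS]/determinant big_distrr /=.
apply: eq_bigr => t _; rewrite -mulrA; congr (_ * (_ * _)).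
by apply: eq_bigr => i _; rewrite !mxE.
Qed.
End Andreief.

Lemma coef_formXn (R : comNzRingType) (h : nat -> R) (B m : nat) :
  coef_form (fun k => h (B.-1 - k)%N) B 'X^m = hz h (B%:Z - 1 - m%:Z).
Proof.
rewrite /coef_form; case: (ltnP m B) => mB.
  rewrite (bigD1 (Ordinal mB)) //= coefXn eqxx mul1r big1 ?addr0 => [|k ne].
    by rewrite (_ : B%:Z - 1 - m%:Z = (B.-1 - m)%N) //; lia.
  rewrite coefXn (_ : (k == m :> nat) = false) ?mul0r //.
  by apply/negbTE; rewrite -[m]/(val (Ordinal mB)).
rewrite big1 => [|k _]; last by rewrite coefXn ltn_eqF ?mul0r // (leq_trans _ mB).
have [j ->] : exists j, B%:Z - 1 - m%:Z = Negz j by exists (m - B)%N; lia.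
by [].
Qed.

Section Dual.
Variables (R : comNzRingType) (h : nat -> R) (c n : nat).
Hypothesis tf : forall m (a : R), a *+ m.+1 = 0 -> a = 0.
Hypothesis n0 : (0 < n)%N.
Let B := (c + n)%N.
Let cf := coef_form (fun k => h (B.-1 - k)%N) B.

(** The image of x^m under the form is h_(c+n-1-m), so a row with exponent m and
    the Schur columns has the entries h_(c-m+j). *)
Definition expdet (col : nat -> {poly R}) (m : seq nat) : R :=
  \det (\matrix_(i < n, j < n) cf ('X^(nth 0%N m i) * col j)).

(** The Littlewood identities, times the alternant of the Schur columns and
    with the denominators absorbed by the Weyl formulas, are identities between
    sums of products of two alternants, to which the form is applied. *)
Lemma expdet_gf (t : R) :
  (\sum_(l <- chains false n B) t ^+ colweight l * expdet (@col_sp n R) (rev l) =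
   \sum_(p < c.+1) t ^+ p * expdet (@col_s n R) (rcons (iota 0 n.-1) (n.-1 + p))) /\
  (\sum_(l <- chains false n B) t ^+ rowweight l * expdet (@col_o n R) (rev l) =
   \sum_(p < n.+1) t ^+ p * expdet (@col_s n R) (iota 0 (n - p) ++ iota (n - p).+1 p)).
Proof.
have B0 : (0 < B)%N by rewrite /B addn_gt0 n0 orbT.
have [K [emb [xs [L [sxs nil lin]]]]] :=
  nilpotent_extension (fun k => h (B.-1 - k)%N) n B0.
rewrite -[in X in X -> _]sxs => Lf.
have inj (a b : R) : a *+ n`! = b *+ n`! -> a = b.
  move=> e; apply: subr0_eq; apply: (@tf n`!.-1).
  by rewrite prednK ?fact_gt0 // mulrnBl e subrr.
pose A (col : nat -> {poly R}) := alternant xs (mkseq (fun j => map_poly emb (col j)) n).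
have LA col ms : size ms = n ->
    L (alternant xs (map (fun b => 'X^b) ms) * A col) = expdet col ms *+ n`!.
  move=> sms; have E := andreief lin Lf (fun i => 'X^(nth 0%N ms i)) col.
  rewrite /= sxs in E; rewrite -[RHS]E; congr (L (alternant _ _ * _)).
  rewrite -{1}(mkseq_nth 0%N ms) sms -map_comp.
  by apply: eq_map => i; rewrite /= map_polyXn.
have Lsum (I : eqType) (r : seq I) col (w : I -> nat) (ms : I -> seq nat) :
    (forall i, i \in r -> size (ms i) = n) ->
    L (\sum_(i <- r) emb t ^+ w i * alternant xs (map (fun b => 'X^b) (ms i)) * A col) =
    (\sum_(i <- r) t ^+ w i * expdet col (ms i)) *+ n`!.
  move=> sm; under eq_bigr do rewrite -rmorphXn -mulrA.
  rewrite (L_sum lin) -sumrMnl !big_seq; apply: eq_bigr => i ir.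
  by rewrite LA ?sm // mulrnAr.
have revl l : catrev [seq 'X^b : {poly K} | b <- l] [::] = map (fun b => 'X^b) (rev l).
  by rewrite catrevE cats0 map_rev.
have As : A (@col_s n R) = alternant xs (mkseq (@col_s n K) n).
  by congr alternant; apply: eq_map => j; rewrite map_polyXn.
have Asp : A (@col_sp n R) = alternant xs (mkseq (@col_sp n K) n).
  congr alternant; apply: eq_map => j; rewrite /col_sp rmorphD /= map_polyXn.
  by case: eqP => _; rewrite ?rmorph0 ?map_polyXn.
have Ao : A (@col_o n R) = alternant xs (mkseq (@col_o n K) n).
  by congr alternant; apply: eq_map => j; rewrite rmorphB /= !map_polyXn.
have sdec l : l \in chains false n B -> size (rev l) = n.
  by rewrite size_rev => /chains_size.
have xs0 : (0 < size xs)%N by rewrite sxs.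
have nil' x : x \in xs -> x ^+ (c + size xs) = 0 by rewrite sxs; apply: nil.
split; apply: inj.
  rewrite -Lsum // -[in RHS](big_mkord xpredT
    (fun p => t ^+ p * expdet _ (rcons _ (_ + p)%N))).
  rewrite -Lsum => [|p _]; last by rewrite size_rcons size_iota prednK.
  have F := colsum_littlewood (emb t) xs0 nil'; rewrite /chain_sum sxs in F.
  have W := weyl_sp xs; rewrite sxs in W.
  congr L; rewrite -!big_distrl /= big_mkord Asp As W mulrCA mulrA.
  under [X in _ = X * _]eq_bigr do rewrite map_rcons -cats1.
  rewrite -[X in _ = X * _]F; congr (_ * _ * _).
  by apply: eq_bigr => l _; rewrite revl.
rewrite -Lsum // -[in RHS](big_mkord xpredT (fun p =>
  t ^+ p * expdet (@col_s n R) (iota 0 (n - p) ++ iota (n - p).+1 p))).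
rewrite -Lsum => [|p]; last first.
  by rewrite mem_index_iota size_cat !size_iota => /andP [_ pn]; rewrite subnK.
have F := rowsum_littlewood (emb t) nil'; rewrite /chain_sum sxs in F.
have W := weyl_sp xs; have W' := weyl_o xs; rewrite !sxs in W W'.
congr L; rewrite -!big_distrl /= big_mkord Ao As W' W !mulrA.
under [X in _ = X * _]eq_bigr do rewrite map_cat.
rewrite -[_ * _ * prod_pairs _ _]mulrA [X in X * _ = _]mulrC; congr (_ * _).
transitivity (\sum_(p < n.+1) emb t ^+ p * alternant xs
   (mkseq (fun b => 'X^b) (n - p) ++ mkseq (fun i => 'X^((n - p + i).+1)) p)).
  rewrite -F; congr (_ * _); apply: eq_bigr => l _; by rewrite revl.
apply: eq_bigr => p _; congr (_ * alternant _ (_ ++ _)).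
by rewrite -[(n - p).+1]addn0 iotaDl -map_comp.
Qed.
End Dual.

(** * Partitions in a rectangle *)
Lemma count_range e d c :
  count (fun j => e <= j < d)%N (iota 0 c) = (minn d c - e)%N.
Proof.
elim: c => [|c IH]; first by rewrite /= minn0 sub0n.
by rewrite -[in LHS]addn1 iotaD count_cat IH /= add0n addn0; lia.
Qed.

Section Rect.
Variables (r c : nat).
Implicit Types nu l : seq nat.

Lemma mem_subparts_rect nu : (nu \in subparts (nseq r c)) =
  [&& size nu == r, sorted geq nu & all (fun x => x <= c)%N nu].
Proof.
rewrite mem_filter /is_part /part_sub.
have hd : (0 < r)%N -> head 0%N (nseq r c) = c by case: (r).
apply/andP/and3P => [[/andP [srt sub] /imageP [tt _ e]]|[/eqP sz srt al]].
  have sz : size nu = r by rewrite e size_map size_tuple size_nseq.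
  split=> //; first by rewrite sz.
  apply/(all_nthP 0%N) => i; rewrite sz => ir.
  have := allP sub i; rewrite mem_iota /= add0n sz => /(_ ir).
  by rewrite nth_nseq ir.
split.
  rewrite srt; apply/allP => i; rewrite mem_iota /= add0n sz => ir.
  by rewrite nth_nseq ir; apply: (all_nthP 0%N al); rewrite sz.
apply/imageP.
have sz' : size (map (inord : nat -> 'I_(head 0%N (nseq r c)).+1) nu) == size (nseq r c).
  by rewrite size_map sz size_nseq.
exists (Tuple sz') => //=; rewrite -map_comp -[LHS]map_id.
apply/eq_in_map => x xnu; rewrite /= inordK // ltnS hd ?(allP al) //.
by rewrite -sz; case: (nu) xnu.
Qed.

Lemma uniq_subparts la : uniq (subparts la).
Proof.
rewrite filter_uniq // map_inj_uniq ?enum_uniq // => s t /(inj_map val_inj).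
exact: val_inj.
Qed.

(** The exponents of the complement of [nu] in the rectangle, increasing. *)
Definition exps nu := mkseq (fun i => c - nth 0 nu i + i)%N r.

Lemma exps_in_dec nu : nu \in subparts (nseq r c) ->
  rev (exps nu) \in chains false r (c + r).
Proof.
rewrite mem_subparts_rect mem_chains => /and3P [/eqP sz srt al].
rewrite size_rev size_mkseq eqxx rev_sorted all_rev /=; apply/andP; split.
  apply/(sortedP 0%N) => i; rewrite size_mkseq => ir.
  rewrite !nth_mkseq //; last exact: ltnW.
  have /(sortedP 0%N) /(_ i) := srt; rewrite sz => /(_ ir) /=; lia.
apply/(all_nthP 0%N) => i; rewrite size_mkseq => ir.
by rewrite nth_mkseq //=; lia.
Qed.

Lemma perm_exps :
  perm_eq [seq rev (exps nu) | nu <- subparts (nseq r c)] (chains false r (c + r)).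
Proof.
apply: uniq_perm (uniq_chains _ _ _) _.
  rewrite map_inj_in_uniq ?uniq_subparts // => nu mu.
  rewrite !mem_subparts_rect => /and3P [/eqP sn _ an] /and3P [/eqP sm _ am] e.
  have {}e : exps nu = exps mu by rewrite -[exps nu]revK e revK.
  apply: (@eq_from_nth _ 0%N); rewrite ?sn ?sm // => i ir.
  have := congr1 (nth 0%N ^~ i) e; rewrite !nth_mkseq //.
  have := all_nthP 0%N an i; have := all_nthP 0%N am i; rewrite sn sm; lia.
move=> l; apply/mapP/idP => [[nu nuP ->]|]; first exact: exps_in_dec.
rewrite mem_chains => /and3P [/eqP sl srt al].
pose s := rev l.
have ss : size s = r by rewrite size_rev.
have stp i : (i.+1 < r)%N -> (nth 0 s i < nth 0 s i.+1)%N.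
  have : sorted ltn s by rewrite /s rev_sorted.
  by move/(sortedP 0%N) => /(_ i); rewrite ss.
have lo i : (i < r)%N -> (i <= nth 0 s i)%N.
  elim: i => // i IH ir; have := stp _ ir; have := IH (ltnW ir); lia.
have hi i : (i < r)%N -> (nth 0 s i <= c + i)%N.
  move=> ir; have [k ek] : exists k, (i + k.+1 = r)%N by exists (r - i.+1)%N; lia.
  elim: k i ir ek => [|k IH] i ir ek.
    have : all (gtn (c + r)%N) s by rewrite all_rev.
    move/(all_nthP 0%N) => /(_ i); rewrite ss => /(_ ir) /=; lia.
  have := stp i; have := IH i.+1; lia.
exists (mkseq (fun i => c + i - nth 0 s i)%N r); last first.
  rewrite -[l]revK; congr rev; apply: (@eq_from_nth _ 0%N).
    by rewrite size_mkseq -ss.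
  move=> i; rewrite -/s ss => ir; rewrite !nth_mkseq //.
  have := lo _ ir; have := hi _ ir; lia.
rewrite mem_subparts_rect size_mkseq eqxx /=; apply/andP; split.
  apply/(sortedP 0%N) => i; rewrite size_mkseq => ir.
  rewrite !nth_mkseq //; last exact: ltnW.
  have := stp _ ir; rewrite /=; lia.
apply/(all_nthP 0%N) => i; rewrite size_mkseq => ir.
rewrite nth_mkseq //; have := lo _ ir; lia.
Qed.

Lemma big_subparts_rect (V : nmodType) (F : seq nat -> V) :
  \sum_(l <- chains false r (c + r)) F l =
  \sum_(nu <- subparts (nseq r c)) F (rev (exps nu)).
Proof. by rewrite -(perm_big _ perm_exps) big_map. Qed.

Lemma oddrows_rowweight nu : oddrows (nseq r c) nu = rowweight (rev (exps nu)).
Proof.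
rewrite /oddrows size_nseq.
have rl i : (i < r)%N -> row_length (nseq r c) nu i = (c - nth 0 nu i)%N.
  move=> ir; rewrite /row_length /in_skew nth_nseq ir.
  have -> : head 0%N (nseq r c) = c by case: (r) ir.
  by rewrite count_range minnn.
have -> : count (fun i => odd (row_length (nseq r c) nu i)) (iota 0 r) =
   count (fun i => odd (c - nth 0 nu i)) (iota 0 r).
  by apply: eq_in_count => i; rewrite mem_iota => /andP [_ ir]; rewrite rl.
clear rl; rewrite /exps; elim: (r) => // m IH.
rewrite -[in LHS]addn1 iotaD count_cat IH mkseqS rev_rcons /= size_rev size_mkseq.
by rewrite add0n addn0 addnC -addnA addnn oddD odd_double addbF.
Qed.

(** [exps] for a partition listed from its last part, in a form suited to
    induction. *)
Fixpoint rexps mu : seq nat :=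
  if mu is d :: mu' then (c - d + size mu')%N :: rexps mu' else [::].

(** Column j of the complement of [mu] has as many cells as [mu] has parts not
    exceeding j.  Prepending two parts d <= e changes the parity of that number
    exactly for d <= j < e. *)
Lemma colweight_rexps mu : sorted leq mu -> all (fun x => x <= c)%N mu ->
  colweight (rexps mu) =
  count (fun j => odd (count (fun d => d <= j)%N mu)) (iota 0 c).
Proof.
have [k] := ubnP (size mu); elim: k mu => // k IH [|d [|e mu]] /= sk srt.
- by rewrite count_pred0.
- move=> /andP [dc _]; rewrite addn0 -{1}(minnn c) -count_range.
  apply: eq_in_count => j; rewrite mem_iota => /andP [_ jc] /=.
  by rewrite addn0 oddb; lia.
move=> /and3P [dc ec al]; move/andP: srt => [de srt].
rewrite IH ?(path_sorted srt) //; last by apply: ltnW.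
have -> : ((c - d + (size mu).+1) - (c - e + size mu).+1 = e - d)%N by lia.
have -> : (e - d = count (fun j => d <= j < e)%N (iota 0 c))%N.
  by rewrite count_range; congr subn; lia.
have dis j : (j < e)%N -> count (fun d => d <= j)%N mu = 0%N.
  move=> je; apply/eqP; rewrite -leqn0 leqNgt -has_count; apply/hasPn => x xmu.
  by have /allP /(_ x xmu) := order_path_min leq_trans srt; lia.
rewrite -count_predUI [X in (_ + X)%N](_ : _ = 0%N) ?addn0; last first.
  apply/eqP; rewrite -leqn0 leqNgt -has_count; apply/hasPn => j _ /=.
  by case: (leqP e j) => ej; rewrite ?andbF //= dis // andbF.
apply: eq_count => j /=; rewrite !oddD !oddb.
case: (leqP e j) => ej; last by rewrite dis //=; case: (d <= j)%N.
by rewrite (leq_trans de ej) /= negbK.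
Qed.

Lemma oddcols_colweight nu : nu \in subparts (nseq r c) ->
  oddcols (nseq r c) nu = colweight (rev (exps nu)).
Proof.
rewrite mem_subparts_rect => /and3P [/eqP sz srt al].
have -> : rev (exps nu) = rexps (rev nu).
  rewrite /exps; elim/last_ind: nu {srt al} r sz => [|nu d IH] r' <- //.
  rewrite size_rcons mkseqS !rev_rcons /= size_rev nth_rcons ltnn eqxx.
  congr (_ :: _); rewrite -(IH (size nu)) //; congr rev; apply/eq_in_map => i.
  by rewrite mem_iota => /andP [_ ir]; rewrite nth_rcons ir.
rewrite colweight_rexps ?all_rev // ?rev_sorted //.
rewrite /oddcols; case: (r) sz => [/size0nil ->|m sz]; first by rewrite /= count_pred0.
apply: eq_in_count => j; rewrite mem_iota => /andP [_ jc].
congr odd; rewrite /col_length size_nseq count_rev -[nu in RHS](mkseq_nth 0%N) sz count_map.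
apply: eq_in_count => i; rewrite mem_iota => /andP [_ ir].
by rewrite /in_skew nth_nseq ir /= jc andbT.
Qed.
End Rect.

(** * Identities for an arbitrary sequence h *)
Section Translate.
Variables (R : comNzRingType) (h : nat -> R) (c n : nat).

Lemma coef_formD (g : nat -> R) B f f' :
  coef_form g B (f + f') = coef_form g B f + coef_form g B f'.
Proof. by rewrite -big_split; apply: eq_bigr => k _; rewrite coefD mulrDl. Qed.

Lemma coef_formN (g : nat -> R) B f : coef_form g B (- f) = - coef_form g B f.
Proof. by rewrite -sumrN; apply: eq_bigr => k _; rewrite coefN mulNr. Qed.

Lemma coef_form0 (g : nat -> R) B : coef_form g B 0 = 0.
Proof. by apply: big1 => k _; rewrite coef0 mul0r. Qed.

Lemma expdet_sp nu : size nu = n -> all (fun x => x <= c)%N nu ->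
  expdet h c n (@col_sp n R) (exps n c nu) = sp_char h nu.
Proof.
move=> sz al; rewrite /expdet /sp_char -sz; congr determinant.
apply/matrixP => i j; rewrite !mxE nth_mkseq // mulrDr coef_formD.
have ni := all_nthP 0%N al i (ltn_ord i); have nj := ltn_ord j.
rewrite -exprD coef_formXn; congr (hz h _ + _); first lia.
case: eqP => _; first by rewrite mulr0 coef_form0.
rewrite -exprD coef_formXn; congr (hz h _); lia.
Qed.

Lemma expdet_o nu : size nu = n -> all (fun x => x <= c)%N nu ->
  expdet h c n (@col_o n R) (exps n c nu) = o_char h nu.
Proof.
move=> sz al; rewrite /expdet /o_char -sz; congr determinant.
apply/matrixP => i j; rewrite !mxE nth_mkseq // mulrBr coef_formD coef_formN.
have ni := all_nthP 0%N al i (ltn_ord i); have nj := ltn_ord j.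
by rewrite -!exprD !coef_formXn; congr (hz h _ - hz h _); lia.
Qed.

Lemma expdet_s nu : size nu = n -> all (fun x => x <= c)%N nu ->
  expdet h c n (@col_s n R) (exps n c nu) = schur h nu.
Proof.
move=> sz al; rewrite /expdet /schur -sz; congr determinant.
apply/matrixP => i j; rewrite !mxE nth_mkseq //.
have ni := all_nthP 0%N al i (ltn_ord i); have nj := ltn_ord j.
by rewrite -!exprD !coef_formXn; congr (hz h _); lia.
Qed.
End Translate.

(** Needed to cancel the factorial of [andreief]. *)
Definition torsion_free (R : nmodType) := forall m (a : R), a *+ m.+1 = 0 -> a = 0.

Section GF.
Variables (R : comNzRingType) (h : nat -> R).
Hypothesis tf : torsion_free R.

Lemma sp_rect_gf r c t : (0 < r)%N ->
  \sum_(nu <- subparts (nseq r c)) t ^+ oddcols (nseq r c) nu * sp_char h nu =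
  \sum_(p < c.+1) t ^+ p * schur h (rcons (nseq r.-1 c) (c - p)%N).
Proof.
move=> r0; have [+ _] := expdet_gf h c tf r0 t; rewrite big_subparts_rect => E.
etransitivity; [|etransitivity; [exact: E|]].
  rewrite !big_seq; apply: eq_bigr => nu nuP; rewrite -oddcols_colweight // revK.
  by move: nuP; rewrite mem_subparts_rect => /and3P [/eqP sz _ al]; rewrite expdet_sp.
apply: eq_bigr => p _; congr (_ * _).
rewrite -(@expdet_s R h c r).
- congr expdet; apply: (@eq_from_nth _ 0%N).
    by rewrite size_rcons size_iota size_mkseq prednK.
  move=> i; rewrite size_rcons size_iota prednK // => ir.
  rewrite nth_mkseq // !nth_rcons size_iota size_nseq nth_nseq.
  case: ltnP => [ir'|ir']; first by rewrite nth_iota // subnn.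
  have -> : i = r.-1 by lia.
  by rewrite eqxx subKn 1?addnC // -ltnS.
- by rewrite size_rcons size_nseq prednK.
by rewrite all_rcons leq_subr /= all_nseq leqnn orbT.
Qed.

Lemma o_rect_gf r c t : (0 < r)%N ->
  \sum_(nu <- subparts (nseq r c)) t ^+ oddrows (nseq r c) nu * o_char h nu =
  \sum_(p < r.+1) t ^+ p *
    expdet h c r (@col_s r R) (iota 0 (r - p) ++ iota (r - p).+1 p).
Proof.
move=> r0; have [_] := expdet_gf h c tf r0 t; rewrite big_subparts_rect => <-.
rewrite !big_seq; apply: eq_bigr => nu nuP; rewrite oddrows_rowweight revK.
by move: nuP; rewrite mem_subparts_rect => /and3P [/eqP sz _ al]; rewrite expdet_o.
Qed.
End GF.

Section Morphism.
Variables (R S : comNzRingType) (f : {rmorphism R -> S}) (h : nat -> R).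

Lemma hz_morph m : hz (f \o h) m = f (hz h m).
Proof. by case: m => [k|k] //=; rewrite rmorph0. Qed.

Lemma schur_morph la : schur (f \o h) la = f (schur h la).
Proof.
rewrite -det_map_mx; congr determinant; apply/matrixP => i j.
by rewrite !mxE hz_morph.
Qed.

Lemma sp_char_morph la : sp_char (f \o h) la = f (sp_char h la).
Proof.
rewrite -det_map_mx; congr determinant; apply/matrixP => i j.
by rewrite !mxE !hz_morph rmorphD /=; case: eqP => _; rewrite ?rmorph0.
Qed.

Lemma o_char_morph la : o_char (f \o h) la = f (o_char h la).
Proof.
rewrite -det_map_mx; congr determinant; apply/matrixP => i j.
by rewrite !mxE !hz_morph rmorphB.
Qed.
End Morphism.

Lemma coef_gf (R : nzRingType) (I : Type) (s : seq I) (w : I -> nat) (a : I -> R) p :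
  (\sum_(i <- s) 'X^(w i) * (a i)%:P)`_p = \sum_(i <- s | w i == p) a i.
Proof.
rewrite coef_sum [RHS]big_mkcond; apply: eq_bigr => i _.
by rewrite coefMC coefXn eq_sym; case: eqP => _; rewrite ?mul1r ?mul0r.
Qed.

Section Rect.
Variables (R : comNzRingType) (h : nat -> R).
Hypothesis tf : torsion_free R.

Lemma torsion_free_poly : torsion_free {poly R}.
Proof.
move=> m a e; apply/polyP => k; rewrite coef0; apply: (tf (m := m)).
by rewrite -coefMn e coef0.
Qed.

(** Coefficient of t^p in the generating function, taken over R[t]. *)
Lemma sp_rect r c p : (0 < r)%N -> (p <= c)%N ->
  schur h (rcons (nseq r.-1 c) (c - p)%N) =
  \sum_(nu <- subparts (nseq r c) | oddcols (nseq r c) nu == p) sp_char h nu.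
Proof.
move=> r0 pc; rewrite -coef_gf.
have := sp_rect_gf (polyC \o h) torsion_free_poly c 'X r0.
under eq_bigr do rewrite sp_char_morph.
move=> ->; under eq_bigr do rewrite schur_morph /=.
by rewrite coef_gf (big_pred1 (Ordinal (pc : p < c.+1)%N)).
Qed.

Lemma o_rect r c p : (p <= r)%N -> ((0 < p)%N -> (0 < c)%N) ->
  schur h (nseq (r - p) c ++ nseq p c.-1) =
  \sum_(nu <- subparts (nseq r c) | oddrows (nseq r c) nu == p) o_char h nu.
Proof.
case: r => [|r].
  rewrite leqn0 => /eqP -> _.
  have e : perm_eq (subparts (nseq 0 c)) [:: [::]].
    apply: uniq_perm => //; first exact: uniq_subparts.
    by move=> nu; rewrite mem_subparts_rect inE; case: nu.
  by rewrite (perm_big _ e) big_mkcond big_seq1 /= /schur /o_char !det_mx00.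
have r0 : (0 < r.+1)%N by []; move: (r.+1) r0 => {}r r0 pr pc; rewrite -coef_gf.
have := o_rect_gf (polyC \o h) torsion_free_poly c 'X r0.
under eq_bigr do rewrite o_char_morph.
have mC ms : expdet (polyC \o h) c r (@col_s r _) ms = (expdet h c r (@col_s r R) ms)%:P.
  rewrite -[_%:P]/(polyC _) -det_map_mx; congr determinant.
  by apply/matrixP => i j; rewrite !mxE -!exprD !coef_formXn hz_morph.
move=> ->; under eq_bigr do rewrite mC.
rewrite coef_gf (big_pred1 (Ordinal (pr : p < r.+1)%N)) //=.
rewrite -(@expdet_s R h c r).
- congr expdet; apply: (@eq_from_nth _ 0%N).
    by rewrite size_cat !size_iota size_mkseq subnK.
  move=> i; rewrite size_mkseq => ir.
  rewrite nth_mkseq // !nth_cat size_iota size_nseq !nth_nseq.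
  case: ltnP => ir'; first by rewrite nth_iota // subnn.
  have ip : (i - (r - p) < p)%N by lia.
  by rewrite ip nth_iota //; have := pc; lia.
- by rewrite size_cat !size_nseq subnK.
by rewrite all_cat !all_nseq leqnn leq_pred !orbT.
Qed.
End Rect.

(** * Complete symmetric functions of a finite alphabet *)
Section Hfin.
Variable R : comNzRingType.
Implicit Types (y : seq R) (a : R) (f : int -> R).

Lemma hfin_chains y m :
  hfin y m = \sum_(l <- chains true m (size y)) \prod_(i <- l) y`_i.
Proof.
pose P (t : m.-tuple 'I_(size y)) := sorted leq (map val t).
have pe : perm_eq (map (fun t : m.-tuple 'I_(size y) => rev (map val t))
                         (filter P (enum {: m.-tuple 'I_(size y)})))
                  (chains true m (size y)).
  apply: uniq_perm (uniq_chains _ _ _) _.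
    rewrite map_inj_uniq => [|s t /(congr1 rev)]; first exact/filter_uniq/enum_uniq.
    by rewrite !revK => /(inj_map val_inj); apply: val_inj.
  move=> l; apply/mapP/idP => [[t]|].
    rewrite mem_filter => /andP [Pt _] ->.
    rewrite mem_chains size_rev size_map size_tuple eqxx rev_sorted all_rev.
    rewrite /=; apply/andP; split; first exact: Pt.
    by rewrite all_map; apply/allP => i _ /=; apply: ltn_ord.
  rewrite mem_chains => /and3P [/eqP sl srt al].
  have [s sE] : exists s : seq 'I_(size y), map val s = rev l.
    exists (pmap insub (rev l)); rewrite (pmap_filter (insubK _)).
    apply/all_filterP; rewrite all_rev; apply: sub_all al => x /= xy.
    by rewrite insubT.
  have ss : size s == m by rewrite -(size_map val) sE size_rev sl.
  exists (Tuple ss); rewrite /= ?sE ?revK //.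
  by rewrite mem_filter mem_enum andbT /P /= sE rev_sorted.
rewrite /hfin -(perm_big _ pe) big_map big_filter big_enum_cond /=.
by apply: eq_bigr => t _; rewrite (perm_big _ (permEl (perm_rev _))) big_map.
Qed.

Lemma hfin0 y : hfin y 0 = 1.
Proof. by rewrite hfin_chains /= big_seq1 big_nil. Qed.

Lemma hfin_nil m : hfin [::] m.+1 = 0 :> R.
Proof. by rewrite hfin_chains /= big_nil. Qed.

Lemma hfin_rcons y a m :
  hfin (rcons y a) m.+1 = hfin y m.+1 + a * hfin (rcons y a) m.
Proof.
rewrite !hfin_chains size_rcons [LHS]big_chains [X in _ = X + _]big_chains.
rewrite big_nat_recr //=; congr (_ + _); last first.
  rewrite big_distrr; apply: eq_bigr => l _ /=.
  by rewrite big_cons nth_rcons ltnn eqxx.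
rewrite !big_nat; apply: eq_bigr => b /andP [_ bn].
rewrite !big_seq; apply: eq_bigr => l; rewrite mem_chains => /and3P [_ _ /allP al].
rewrite !big_seq; apply: eq_bigr => i; rewrite inE => il.
have ib : (i <= b)%N by case/orP: il => [/eqP -> //|/al].
by rewrite nth_rcons (leq_ltn_trans ib bn).
Qed.

(** Multiplication of the generating function of [f] by 1 - a t. *)
Definition bdiff a f (m : int) := f m - a * f (m - 1).

Lemma bdiff_ext a f g : f =1 g -> bdiff a f =1 bdiff a g.
Proof. by move=> fg m; rewrite /bdiff !fg. Qed.

Definition bdiffs y f := foldr bdiff f y.

Lemma bdiffs_ext y f g : f =1 g -> bdiffs y f =1 bdiffs y g.
Proof. by move=> fg; elim: y => //= a y IH; apply: bdiff_ext. Qed.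

Lemma bdiffs_mid y1 a y2 f : bdiffs (y1 ++ a :: y2) f =1 bdiff a (bdiffs (y1 ++ y2) f).
Proof.
elim: y1 => //= b y1 IH m; rewrite (bdiff_ext _ IH) /bdiff; ring.
Qed.

Lemma bdiff_hfin y a : bdiff a (hz (hfin (rcons y a))) =1 hz (hfin y).
Proof.
move=> [[|k]|k] /=; rewrite /bdiff.
- by rewrite /= !hfin0 mulr0 subr0.
- rewrite (_ : k.+1%:Z - 1 = k); last by lia.
  by rewrite /= hfin_rcons addrK.
by rewrite (_ : Negz k - 1 = Negz k.+1) /= ?mulr0 ?subr0 //; lia.
Qed.

(** The generating function of the h_m is the inverse of prod (1 - a t). *)
Lemma bdiffs_hfin y : bdiffs y (hz (hfin y)) =1 fun m => (m == 0)%:R.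
Proof.
elim/last_ind: y => [|y a IH] m /=.
  by case: m => [[|k]|k] //=; rewrite ?hfin0 ?hfin_nil.
rewrite -IH /bdiffs foldr_rcons; apply: bdiffs_ext; exact: bdiff_hfin.
Qed.

Fixpoint bdiff_coef y (d : nat) : R :=
  if y is a :: y' then bdiff_coef y' d - (if d is d'.+1 then a * bdiff_coef y' d' else 0)
  else (d == 0%N)%:R.

Lemma bdiff_coef_oversize y d : (size y < d)%N -> bdiff_coef y d = 0.
Proof.
elim: y d => [|a y IH] [|d] //= yd.
by rewrite !IH ?mulr0 ?subr0 // ltnW.
Qed.

Lemma bdiffsE y f m : bdiffs y f m = \sum_(d < (size y).+1) bdiff_coef y d * f (m - d%:Z).
Proof.
elim: y m => [|a y IH] m /=; first by rewrite big_ord1 mul1r subr0.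
rewrite /bdiff !IH; under [RHS]eq_bigr do rewrite mulrBl.
rewrite sumrB [X in _ = X - _]big_ord_recr bdiff_coef_oversize //= mul0r addr0.
rewrite [X in _ = _ - X]big_ord_recl /= mul0r add0r big_distrr; congr (_ - _).
apply: eq_bigr => d _ /=; rewrite mulrA; congr (_ * f _).
by rewrite /bump /=; lia.
Qed.

(** Cancelling all factors but one leaves 1 / (1 - a t). *)
Lemma bdiffs_hfin_rem y1 a y2 (k : nat) :
  bdiffs (y1 ++ y2) (hz (hfin (y1 ++ a :: y2))) k = a ^+ k.
Proof.
set u := bdiffs _ _.
have uop m : u m - a * u (m - 1) = (m == 0)%:R.
  by rewrite -[LHS]/(bdiff a u m) -bdiffs_mid bdiffs_hfin.
have u0 : u (-1) = 0.
  rewrite /u bdiffsE big1 // => d _.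
  by rewrite (_ : -1 - d%:Z = Negz d) /= ?mulr0 //; lia.
elim: k => [|k IH].
  by have := uop 0; rewrite sub0r u0 mulr0 subr0.
have := uop k.+1; rewrite (_ : k.+1%:Z - 1 = k) ?IH; last by lia.
by move=> /eqP; rewrite subr_eq add0r => /eqP ->; rewrite exprS.
Qed.

(** Each y_j^e is a combination of N consecutive h_m whose coefficients, those
    of the product of the other 1 - y_i t, do not depend on e. *)
Lemma bialternant y (N := size y) : exists M : 'M[R]_N, forall e : 'I_N -> nat,
  \det (\matrix_(i < N, j < N) y`_j ^+ e i) =
  \det (\matrix_(i < N, k < N) hz (hfin y) ((e i)%:Z - N.-1%:Z + k%:Z)) * \det M.
Proof.
pose rest (j : nat) := take j y ++ drop j.+1 y.
exists (\matrix_(k < N, j < N) bdiff_coef (rest j) (N.-1 - k)) => e.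
rewrite -det_mulmx; congr determinant; apply/matrixP => i j; rewrite !mxE.
have yE : y = take j y ++ y`_j :: drop j.+1 y by rewrite -drop_nth // cat_take_drop.
have sr : (size (rest j)).+1 = N.
  have jN := ltn_ord j; rewrite size_cat size_drop size_takel; last exact: ltnW.
  by rewrite -/N; lia.
rewrite -(bdiffs_hfin_rem (take j y) _ (drop j.+1 y)) -yE -/(rest j) bdiffsE sr.
rewrite (reindex_inj rev_ord_inj); apply: eq_bigr => k _.
rewrite !mxE mulrC /=; have kN := ltn_ord k.
congr (hz _ _ * bdiff_coef _ _); lia.
Qed.
End Hfin.

(** * Schur functions: branching and complements *)
Section Schur.
Variable R : comNzRingType.
Implicit Types (h : nat -> R) (la : seq nat).

Lemma schur_rcons0 h la : h 0%N = 1 -> schur h (rcons la 0%N) = schur h la.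
Proof.
move=> h0; rewrite /schur size_rcons (expand_det_row _ ord_max).
rewrite big_ord_recr big1 /= ?add0r => [|j _]; last first.
  rewrite mxE /= nth_rcons ltnn eqxx.
  have [k ->] : exists k, 0%N%:Z - (size la)%:Z + j%:Z = Negz k.
    by exists (size la - j.+1)%N; have := ltn_ord j; lia.
  by rewrite mul0r.
rewrite mxE /= nth_rcons ltnn eqxx (_ : _ - _ + _ = 0); last by lia.
rewrite [hz h 0]h0 mul1r /cofactor addnn -signr_odd odd_double mul1r.
congr determinant; apply/matrixP => i j; rewrite !mxE !lift_max nth_rcons.
by rewrite ltn_ord.
Qed.

Lemma schur_pad h la k : h 0%N = 1 -> schur h (la ++ nseq k 0%N) = schur h la.
Proof.
move=> h0; elim: k => [|k IH]; first by rewrite cats0.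
by rewrite -[k.+1]addn1 nseqD catA cats1 schur_rcons0.
Qed.

(** Subtracting from each row the next one replaces the complete symmetric
    functions of the larger alphabet by those of [y], except in the last row,
    which is a sum of rows for [y]. *)
Lemma schur_branch_rect (y : seq R) r c : (0 < r)%N ->
  schur (hfin (rcons y 1)) (nseq r c) =
  \sum_(p < c.+1) schur (hfin y) (rcons (nseq r.-1 c) (c - p)%N).
Proof.
case: r => // r _; rewrite [r.+1.-1]/=.
set h' := hfin (rcons y 1); set h := hfin y.
have dh m : hz h' m - hz h' (m - 1) = hz h m.
  by rewrite -(bdiff_hfin y 1) /bdiff mul1r.
have sumh k m : hz h' m = \sum_(p < k) hz h (m - p%:Z) + hz h' (m - k%:Z).
  elim: k => [|k IH]; first by rewrite big_ord0 add0r subr0.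
  rewrite IH big_ord_recr /= -addrA; congr (_ + _).
  by rewrite -dh (_ : m - k.+1%:Z = m - k%:Z - 1) ?subrK //; lia.
pose A := \matrix_(i < r.+1, j < r.+1) hz h' (c%:Z - i%:Z + j%:Z).
pose U := \matrix_(i < r.+1, k < r.+1)
   (if k == i then 1 else if (k == i.+1 :> nat) then -1 else 0 : R).
have detU : \det U = 1.
  rewrite -det_tr det_trig; first by apply: big1 => i _; rewrite !mxE eqxx.
  apply/is_trig_mxP => i j ij; rewrite !mxE -val_eqE /= ltn_eqF //.
  by rewrite ltn_eqF // ltnW.
have UA (i j : 'I_r.+1) : (i < r)%N -> (U *m A) i j = hz h (c%:Z - i%:Z + j%:Z).
  move=> ir; have i1 : (i.+1 < r.+1)%N by [].
  rewrite mxE (bigD1 i) //= (bigD1 (Ordinal i1)) /=; last by rewrite -val_eqE /= gtn_eqF.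
  rewrite big1 ?addr0 => [|k /andP [ki ki1]].
    rewrite !mxE eqxx mul1r -val_eqE /= gtn_eqF // eqxx mulN1r -dh.
    by congr (_ - hz _ _); lia.
  by rewrite !mxE (negbTE ki) -[i.+1]/(val (Ordinal i1)) val_eqE (negbTE ki1) mul0r.
have UAr (j : 'I_r.+1) : (U *m A) ord_max j = hz h' (c%:Z - r%:Z + j%:Z).
  rewrite mxE (bigD1 ord_max) //= big1 ?addr0 => [|k kr].
    by rewrite !mxE eqxx mul1r.
  by rewrite !mxE (negbTE kr) ltn_eqF ?mul0r.
have -> : schur h' (nseq r.+1 c) = \det (U *m A).
  rewrite det_mulmx detU mul1r /schur size_nseq; congr determinant.
  by apply/matrixP => i j; rewrite !mxE nth_nseq ltn_ord.
rewrite (expand_det_row _ ord_max).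
transitivity (\sum_(j < r.+1) \sum_(p < c.+1)
   hz h ((c - p)%N%:Z - r%:Z + j%:Z) * cofactor (U *m A) ord_max j).
  apply: eq_bigr => j _; rewrite -big_distrl /=; congr (_ * _).
  rewrite UAr (sumh c.+1) [X in _ + X](_ : _ = 0) ?addr0; last first.
    have [k ->] : exists k, c%:Z - r%:Z + j%:Z - c.+1%:Z = Negz k.
      by exists (r - j)%N; have := ltn_ord j; lia.
    by [].
  by apply: eq_bigr => p _; congr (hz h _); have := ltn_ord p; lia.
rewrite exchange_big; apply: eq_bigr => p _.
rewrite /schur size_rcons size_nseq (expand_det_row _ ord_max).
apply: eq_bigr => j _; rewrite mxE nth_rcons size_nseq /= ltnn eqxx; congr (_ * _).
rewrite /cofactor; congr (_ * \det _); apply/matrixP => i k.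
rewrite 2!mxE UA ?lift_max // !mxE nth_rcons size_nseq lift_max ltn_ord.
by rewrite nth_nseq ltn_ord.
Qed.
End Schur.

Section Complement.
Variables (F : fieldType) (y : seq F).
Hypotheses (uy : uniq y) (invy : forall a, a \in y -> a^-1 \in y).
Hypothesis prody : \prod_(a <- y) a = 1.
Let N := size y.

Definition bialternant_det (la : seq nat) : F :=
  \det (\matrix_(i < N, j < N) y`_j ^+ (nth 0%N la i + (N.-1 - i))).

(** The factor is a Vandermonde determinant up to sign: it is the value at the
    zero partition, whose Schur function is 1. *)
Lemma bialt_schur : exists2 d : F, d != 0 &
  forall la, size la = N -> bialternant_det la = schur (hfin y) la * d.
Proof.
have [M ME] := bialternant y.
have E la : size la = N -> bialternant_det la = schur (hfin y) la * \det M.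
  move=> sz; rewrite /bialternant_det (ME (fun i => nth 0 la i + (N.-1 - i))%N) /schur sz.
  congr (\det _ * _); apply/matrixP => i k; rewrite !mxE; congr (hz _ _).
  by have := ltn_ord i; rewrite -/N; lia.
exists (\det M) => //; apply/eqP => d0.
have := E (nseq N 0%N) (size_nseq _ _); rewrite d0 mulr0 => /eqP.
have -> : bialternant_det (nseq N 0%N) =
    \det (row_perm (perm (@rev_ord_inj N)) (Vandermonde N (\row_j y`_j))).
  congr determinant; apply/matrixP => i j; rewrite !mxE permE nth_nseq ltn_ord add0n /=.
  by congr (_ ^+ _); have := ltn_ord i; lia.
rewrite row_permE det_mulmx det_perm mulf_eq0 signr_eq0 /= det_Vandermonde.
apply/negP/prodf_neq0 => i _; apply/prodf_neq0 => j ij.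
by rewrite !mxE subr_eq0 nth_uniq // gtn_eqF.
Qed.

(** Inverting the letters permutes the columns, reversing the order of the rows
    gives the complement, and the powers of the product of all letters are 1. *)
Lemma bialt_complement : exists s : F, forall c la, size la = N ->
  all (fun x => x <= c)%N la ->
  bialternant_det (rev (map (subn c) la)) = s * bialternant_det la.
Proof.
have y0 (j : 'I_N) : y`_j != 0.
  apply/eqP => y0; have := oner_neq0 F; rewrite -prody (big_nth 0) big_mkord.
  by rewrite (bigD1 j) //= y0 mul0r eqxx.
have piP (j : 'I_N) : (index (y`_j)^-1 y < N)%N by rewrite index_mem invy // mem_nth.
pose pi (j : 'I_N) := Ordinal (piP j).
have piE j : y`_(pi j) = (y`_j)^-1 by rewrite nth_index // invy // mem_nth.
have pi_inj : injective pi.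
  move=> j k e; apply/val_inj/eqP.
  rewrite -(nth_uniq 0 (ltn_ord j) (ltn_ord k) uy).
  by apply/eqP/invr_inj; rewrite -!piE e.
pose rho := perm (@rev_ord_inj N).
exists ((-1) ^+ rho * (-1) ^+ perm pi_inj) => c la sz al.
rewrite /bialternant_det.
pose A := \matrix_(i < N, j < N) y`_j ^+ (nth 0%N la i + (N.-1 - i)).
have prodj : \prod_(j < N) y`_j = 1.
  by rewrite -[RHS]prody [RHS](big_nth 0) big_mkord.
transitivity (\det (row_perm rho (col_perm (perm pi_inj) A *m
    diag_mx (\row_j y`_j ^+ (c + N.-1))))).
  rewrite mul_mx_diag; congr determinant; apply/matrixP => i j.
  rewrite !mxE !permE piE exprVn /=.
  have iN := ltn_ord i.
  rewrite nth_rev ?size_map ?sz // (nth_map 0%N) ?sz; last by lia.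
  set x := nth 0%N la _; have xc : (x <= c)%N by apply: (all_nthP 0%N al); rewrite sz; lia.
  have e : (c + N.-1 = c - x + (N.-1 - i) + (x + (N.-1 - (N - i.+1))))%N by lia.
  by rewrite [RHS]mulrC e [X in _ = X * _]exprD mulfK ?expf_neq0.
rewrite row_permE col_permE !det_mulmx !det_perm det_diag odd_permV.
have -> : \prod_(i < N) (\row_j y`_j ^+ (c + N.-1)) 0 i = 1.
  under eq_bigr do rewrite mxE.
  by rewrite prodrXl prodj expr1n.
by rewrite mulr1 mulrA mulrAC.
Qed.

(** The sign is the same for all partitions, hence 1 as for the zero partition
    in its own rectangle of width 0. *)
Theorem schur_complement c la : size la = N -> all (fun x => x <= c)%N la ->
  schur (hfin y) (rev (map (subn c) la)) = schur (hfin y) la.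
Proof.
move=> sz al; have [d d0 bs] := bialt_schur; have [s sE] := bialt_complement.
have s1 : s = 1.
  have s0 : schur (hfin y) (nseq N 0%N) = 1.
    by rewrite -[nseq N _]cat0s schur_pad ?hfin0 // /schur det_mx00.
  have := sE 0%N (nseq N 0%N) (size_nseq _ _); rewrite all_nseq orbT => /(_ isT).
  have -> : rev (map (subn 0) (nseq N 0%N)) = nseq N 0%N by rewrite map_nseq rev_nseq.
  rewrite bs ?size_nseq // s0 mul1r => e.
  by apply: (mulIf d0); rewrite mul1r -e.
have := sE c la sz al; rewrite s1 mul1r !bs ?size_rev ?size_map //.
exact: mulIf.
Qed.
End Complement.

(** * The alphabet of letters x, 1/x and possibly 1 *)
Section Letters.
Variables (F : fieldType) (I : eqType) (X : I -> F).
Hypotheses (X0 : forall i, X i != 0) (X1 : forall i, X i != 1).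
Hypotheses (Xi : injective X) (XV : forall i j, X i * X j != 1).

Definition letters (s : seq I) := flatten [seq [:: X i; (X i)^-1] | i <- s].

Lemma lettersP s a :
  reflect (exists2 i, i \in s & (a = X i) \/ (a = (X i)^-1)) (a \in letters s).
Proof.
apply: (iffP flatten_mapP) => [[i si]|[i si H]].
  by rewrite !inE => /orP [] /eqP ->; exists i => //; [left | right].
by exists i => //; rewrite !inE; case: H => ->; rewrite eqxx ?orbT.
Qed.

Lemma uniq_letters s (b : bool) : uniq s -> uniq (letters s ++ nseq b 1).
Proof.
move=> us; have neV i j : (X i == (X j)^-1) = false.
  by apply/negbTE/eqP => e; have := XV i j; rewrite e mulVf ?X0 // eqxx.
rewrite cat_uniq; apply/and3P; split; last by case: b.
  elim: s us => //= i s IH /andP [si us]; rewrite IH // inE neV /= andbT.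
  apply/andP; split; apply/negP => /lettersP [j sj [e|e]].
  - by move: si; rewrite (Xi e) sj.
  - by have := neV i j; rewrite e eqxx.
  - by have := neV j i; rewrite e eqxx.
  - by move: si; rewrite (Xi (invr_inj e)) sj.
apply/hasPn => a; rewrite mem_nseq => /andP [_ /eqP ->].
apply/negP => /lettersP [i _ [e|e]]; first by have := X1 i; rewrite -e eqxx.
by have := X1 i; rewrite -[X i]invrK -e invr1 eqxx.
Qed.

Lemma letters_inv s (b : bool) a :
  a \in letters s ++ nseq b 1 -> a^-1 \in letters s ++ nseq b 1.
Proof.
rewrite !mem_cat !mem_nseq => /orP [/lettersP [i si H]|/andP [-> /eqP ->]].
  apply/orP; left; apply/lettersP; exists i => //.
  by case: H => ->; [right | left; rewrite invrK].
by rewrite invr1 eqxx orbT.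
Qed.

Lemma prod_letters s (b : bool) : \prod_(a <- letters s ++ nseq b 1) a = 1.
Proof.
rewrite big_cat /= [X in _ * X]big1_seq ?mulr1; last first.
  by move=> a /=; rewrite mem_nseq => /andP [_ /eqP].
rewrite big_flatten big_map big1 // => i _.
by rewrite !big_cons big_nil /= mulr1 mulfV.
Qed.

Lemma size_letters s (b : bool) : size (letters s ++ nseq b 1) = ((size s).*2 + b)%N.
Proof.
rewrite size_cat size_nseq; congr (_ + _)%N.
by elim: s => //= i s ->.
Qed.
End Letters.

Section Alphabet.
Variable n : nat.
Local Notation F := {fraction {mpoly int[n]}}.
Let X (i : 'I_n) : F := tofrac 'X_i.

(** Letters are told apart by evaluating polynomials at integers. *)
Lemma mpoly_neq (p q : {mpoly int[n]}) (v : 'I_n -> int) :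
  p.@[v] != q.@[v] -> tofrac p != tofrac q.
Proof. by rewrite tofrac_eq; apply: contraNneq => ->. Qed.

Lemma letter_neq0 i : X i != 0.
Proof. by rewrite /X -tofrac0; apply: (mpoly_neq (v := fun=> 1)); rewrite mevalXU meval0. Qed.

Lemma letter_neq1 i : X i != 1.
Proof. by rewrite /X -tofrac1; apply: (mpoly_neq (v := fun=> 0)); rewrite mevalXU meval1. Qed.

Lemma letter_mul_neq1 i j : X i * X j != 1.
Proof.
rewrite /X -tofracM -tofrac1; apply: (mpoly_neq (v := fun=> 0)).
by rewrite mevalM !mevalXU meval1 mulr0.
Qed.

Lemma letter_inj : injective X.
Proof.
move=> i j e; apply/eqP/negPn/negP => ne.
have := @mpoly_neq 'X_i 'X_j (fun k => (k == i)%:R).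
rewrite !mevalXU eqxx eq_sym (eq_sym j) (negbTE ne) => /(_ isT).
by rewrite -/(X i) -/(X j) e eqxx.
Qed.

Lemma xpmE (b : bool) : xpm n b = letters X (enum 'I_n) ++ nseq b 1.
Proof. by []. Qed.

Lemma size_xpm (b : bool) : size (xpm n b) = (n.*2 + b)%N.
Proof. by rewrite xpmE size_letters size_enum_ord. Qed.

Lemma xpm_true : xpm n true = rcons (xpm n false) 1.
Proof. by rewrite !xpmE cats0 -cats1. Qed.

Lemma xpm_complement (b : bool) c la : size la = (n.*2 + b)%N ->
  all (fun x => x <= c)%N la -> s_pm n b (rev (map (subn c) la)) = s_pm n b la.
Proof.
move=> sz; apply: schur_complement; last by rewrite size_xpm.
- exact: (uniq_letters letter_neq0 letter_neq1 (@letter_inj) letter_mul_neq1 _ (enum_uniq _)).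
- exact: letters_inv.
- exact: prod_letters letter_neq0 _ _.
Qed.

Lemma torsion_free_fraction : torsion_free F.
Proof.
move=> m a /eqP; rewrite -mulr_natr mulf_eq0 => /orP [/eqP //|].
have /negbTE -> // : (m.+1%:R : F) != 0.
rewrite -tofrac1 -tofracMn -tofrac0; apply: (mpoly_neq (v := fun=> 0)).
by rewrite mevalMn meval1 meval0 Num.Theory.pnatr_eq0.
Qed.
End Alphabet.

Lemma torsion_free_pseries : torsion_free (pseries int).
Proof.
move=> m f e; apply: pseriesP => A /=.
have mE k : (f *+ k) A = f A *+ k.
  elim: k => [|k IH]; first by rewrite !mulr0n.
  by rewrite !mulrS -IH.
have /eqP := congr1 (fun g : pseries int => g A) e; rewrite mE /=.
by rewrite Num.Theory.mulrn_eq0 /= => /eqP.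
Qed.

(** * The identities for rectangular shapes *)
Theorem theorem1 (r c p : nat) :
  [/\ (* (i) *)
      (0 < r)%N -> (p <= c)%N ->
      schur hinf (rcons (nseq r.-1 c) (c - p)%N) =
        \sum_(nu <- subparts (nseq r c) | oddcols (nseq r c) nu == p)
           sp_char hinf nu,
      (* (ii) *)
      (p <= r)%N -> ((0 < p)%N -> (0 < c)%N) ->
      schur hinf (nseq (r - p) c ++ nseq p c.-1) =
        \sum_(nu <- subparts (nseq r c) | oddrows (nseq r c) nu == p)
           o_char hinf nu,
      (* (iii) *)
      forall N : nat, (0 < r)%N -> (r <= N)%N -> (p <= c)%N ->
      s_pm N./2 (odd N) (rcons (nseq r.-1 c) (c - p)%N) =
        if (r <= uphalf N)%N then
          \sum_(nu <- subparts (nseq r c) | oddcols (nseq r c) nu == p)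
             sp_pm N./2 (odd N) nu
        else
          \sum_(nu <- subparts (nseq (N - r + 1) c)
                 | oddcols (nseq (N - r + 1) c) nu == (c - p)%N)
             sp_pm N./2 (odd N) nu,
      (* (iv) *)
      forall n : nat, (r <= n.*2.+1)%N ->
      s_pm n true (nseq r c) =
        if (r <= n)%N then
          \sum_(nu <- subparts (nseq r c)) sp_pm n false nu
        else
          \sum_(nu <- subparts (nseq (n.*2.+1 - r) c)) sp_pm n false nu
    & (* (v) *)
      forall N : nat, (p <= r)%N -> (r <= N./2)%N -> ((0 < p)%N -> (0 < c)%N) ->
      s_pm N./2 (odd N) (nseq (r - p) c ++ nseq p c.-1) =
        \sum_(nu <- subparts (nseq r c) | oddrows (nseq r c) nu == p)
           o_pm N./2 (odd N) nu].
Proof.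
(* Summing (i) over p, that is t = 1, undoes the branching of the rectangle. *)
have branch n k : s_pm n true (nseq k c) =
    \sum_(nu <- subparts (nseq k c)) sp_pm n false nu.
  case: (posnP k) => [->|k0]; first last.
    rewrite /s_pm xpm_true schur_branch_rect //.
    have := sp_rect_gf (hfin (xpm n false)) (@torsion_free_fraction n) c 1 k0.
    under eq_bigr do rewrite expr1n mul1r.
    by move=> ->; apply: eq_bigr => q _; rewrite expr1n mul1r.
  have e : perm_eq (subparts (nseq 0 c)) [:: [::]].
    apply: uniq_perm => //; first exact: uniq_subparts.
    by move=> nu; rewrite mem_subparts_rect inE; case: nu.
  by rewrite (perm_big _ e) big_seq1 /s_pm /sp_pm /schur /sp_char !det_mx00.
split.
- exact: (sp_rect _ torsion_free_pseries).
- exact: (o_rect _ torsion_free_pseries).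
- move=> N r0 rN pc; have tf := @torsion_free_fraction N./2.
  case: ifP => _; first exact: sp_rect.
  (* The complement in the rectangle with N rows has N - r + 1 rows and c - p in
     place of p. *)
  have N2 : (N./2.*2 + odd N)%N = N by rewrite addnC odd_double_half.
  set la := rcons _ _.
  have pad mu : s_pm N./2 (odd N) mu = s_pm N./2 (odd N) (mu ++ nseq (N - size mu) 0%N).
    by rewrite /s_pm schur_pad ?hfin0.
  have sla : size la = r by rewrite size_rcons size_nseq prednK.
  rewrite pad sla -(@xpm_complement _ _ c); first last.
  + by rewrite all_cat all_rcons !all_nseq leqnn leq_subr !orbT.
  + by rewrite size_cat size_nseq sla N2 subnKC.
  rewrite map_cat map_rcons !map_nseq subn0 subnn rev_cat rev_rcons !rev_nseq.
  rewrite -cat_rcons subKn // /s_pm schur_pad ?hfin0 //.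
  have := @sp_rect _ (hfin (xpm N./2 (odd N))) tf (N - r + 1) c (c - p).
  by rewrite addn1 /= subKn // => ->; rewrite ?leq_subr.
- move=> n rn; case: ifP => _; first exact: branch.
  rewrite -branch /s_pm -(schur_pad _ (n.*2.+1 - r)) ?hfin0 //.
  rewrite -/(s_pm n true _) -(@xpm_complement _ _ c); first last.
  + by rewrite all_cat !all_nseq leqnn !orbT.
  + by rewrite size_cat !size_nseq subnKC // addn1.
  by rewrite map_cat !map_nseq subn0 subnn rev_cat !rev_nseq /s_pm schur_pad ?hfin0.
- by move=> N pr _ pc; apply: (o_rect _ (@torsion_free_fraction _)).
Qed.
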